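(* Let $X,\Sigma,(A_n),\mathcal A(m,n),(P_n),\hat{\mathcal G},f_\lambda,(c_n)$ be as in the context. Assume that $x_{n+1}=A_nx_n$, $n\in\mathbb Z$, admits no non-trivial bounded solution, that $$\hat q:=\sup_{m\in\mathbb Z}\Big(\sum_{n\in\mathbb Z}c_{n-1}\|\hat{\mathcal G}(m,n)\|\Big)<1,$$ and that $(\epsilon_n)_{n\in\mathbb Z}$ is a sequence in $(0,+\infty)$ with $$\hat L:=\sup_{m\in\mathbb Z}\Big(\sum_{n\in\mathbb Z}\epsilon_{n-1}\|\hat{\mathcal G}(m,n)\|\Big)<\infty.$$ For each $\lambda\in\Sigma$ let $\mathbf y^\lambda=(y^\lambda_n)_{n\in\mathbb Z}\subset X$ be a sequence satisfying $$|y^\lambda_{n+1}-A_ny^\lambda_n-f_\lambda(n,y^\lambda_n)|\le\epsilon_n\quad\text{for all }n\in\mathbb Z,$$ and let $\mathbf x^\lambda=(x^\lambda_n)_{n\in\mathbb Z}\subset X$ be the unique sequence satisfying $x^\lambda_{n+1}=A_nx^\lambda_n+f_\lambda(n,x^\lambda_n)$ for all $n\in\mathbb Z$ and $|x^\lambda_n-y^\lambda_n|\le\frac{\hat L}{1-\hat q}$ for every $n\in\mathbb Z$. Take $k\in\mathbb N$ and suppose there exists $C>0$ such that the following conditions hold: (1) for every $n\in\mathbb Z$ the map $(\lambda,x)\mapsto f_\lambda(n,x)$ is $C^{k+1}$, and for all $2\le i\le k+1$ and $0\le j\le i$, $$\sup_{\lambda\in\Sigma}\sup_{x\in X}\left\|\frac{\partial^i}{\partial\lambda^{i-j}\partial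 x^j}f_\lambda(n,x)\right\|\le C\epsilon_n;$$ (2) the map $\lambda\mapsto y^\lambda_n$ is $C^{k+1}$ for every $n\in\mathbb Z$ and $$\left|\frac{\partial^i}{\partial\lambda^i}y^\lambda_{n+1}-A_n\frac{\partial^i}{\partial\lambda^i}y^\lambda_n-\frac{d^i}{d\lambda^i}f_\lambda(n,y^\lambda_n)\right|\le C\epsilon_n$$ for every $1\le i\le k+1$, all $n\in\mathbb Z$ and all $\lambda\in\Sigma$. Furthermore, for every $\lambda_0\in\Sigma$ there exist $\hat M_{\lambda_0}>1$ and a neighborhood $\Sigma_0$ of $\lambda_0$ such that $$\max_{1\le i\le k+1}\sup_{n\in\mathbb Z}\left\|\frac{\partial^i}{\partial\lambda^i}y^\lambda_n\right\|\le\hat M_{\lambda_0}\quad\text{for each }\lambda\in\Sigma_0.$$ Then the map $\lambda\mapsto x^\lambda_n$ is of class $C^k$ on $\Sigma$ for every $n\in\mathbb Z$.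
   Context: $X=(X,|\cdot|)$ is an arbitrary Banach space; $\mathcal B(X)$ is the space of bounded linear operators on $X$ with operator norm $\|\cdot\|$. $\Sigma$ is an open subset of another Banach space, whose norm is also denoted $|\cdot|$. $(A_n)_{n\in\mathbb Z}$ is a sequence of invertible operators in $\mathcal B(X)$ and, for $m,n\in\mathbb Z$, $$\mathcal A(m,n)=\begin{cases}A_{m-1}\cdots A_n& m>n,\\ \mathrm{Id}& m=n,\\ A_m^{-1}\cdots A_{n-1}^{-1}& m<n.\end{cases}$$ $(P_n)_{n\in\mathbb Z}$ is a sequence in $\mathcal B(X)$ and $$\hat{\mathcal G}(m,n)=\begin{cases}\mathcal A(m,n)P_n& m\ge n,\\ -\mathcal A(m,n)(\mathrm{Id}-P_n)& m<n.\end{cases}$$ For each $\lambda\in\Sigma$, $f_\lambda\colon\mathbb Z\times X\to X$ is a measurable map, and there is a sequence $(c_n)_{n\in\mathbb Z}$ in $[0,\infty)$ such that $|f_\lambda(n,x)-f_\lambda(n,y)|\le c_n|x-y|$ for every $n\in\mathbb Z$, $\lambda\in\Sigma$ and $x,y\in X$. Under the stated hypotheses (no non-trivial bounded solution, $\hat q<1$, $\hat L<\infty$, $\mathbf y^\lambda$ approximate solution) it is known that for each $\lambda\in\Sigma$ the sequence $\mathbf x^\lambda$ described in the claim exists and is unique. The symbols $\frac{\partial^i}{\partial\lambda^{i-j}\partial x^j}$ denote partial Fréchet derivatives, and $\frac{d^i}{d\lambda^i}f_\lambda(n,y^\lambda_n)$ is the $i$-th (total) derivative of $\lambda\mapsto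 f_\lambda(n,y^\lambda_n)$; norms of derivatives are norms of the corresponding multilinear maps. *)

(* Defs.v *)
From HB Require Import structures.
From mathcomp Require Import all_boot all_order all_algebra.
From mathcomp Require Import all_classical all_reals all_analysis.

Set Implicit Arguments.
Unset Strict Implicit.
Unset Printing Implicit Defensive.
Import Order.TTheory GRing.Theory Num.Theory.
Import numFieldNormedType.Exports.
Local Open Scope classical_set_scope.
Local Open Scope ring_scope.

Section BoundedLinear.
Context {R : realType} (V W : normedModType R).

Definition bounded_operator (f : V -> W) : Prop :=
  linear f /\ exists M : R, forall x, `|f x| <= M * `|x|.

Definition bop_pred : {pred V -> W} := mem [set f | bounded_operator f].

Lemma bop_predP (f : V -> W) : reflect (bounded_operator f) (f \in bop_pred).
Proof. by apply: (iffP idP) => [/set_mem|/mem_set]. Qed.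

Lemma bop_submod_closed : submod_closed bop_pred.
Proof.
split.
  apply/bop_predP; split; first by move=> a x y; rewrite /= scaler0 addr0.
  by exists 0 => x; rewrite normr0 mul0r.
move=> a f g /bop_predP[lf [M fM]] /bop_predP[lg [N gN]]; apply/bop_predP.
split=> [b x y|].
  rewrite !fctE lf lg !scalerDr !scalerA (mulrC a b).
  by rewrite addrACA.
exists (`|a| * M + N) => x; rewrite !fctE (le_trans (ler_normD _ _))//.
by rewrite normrZ mulrDl lerD// -mulrA ler_wpM2l.
Qed.

HB.instance Definition _ :=
  GRing.isSubmodClosed.Build R (V -> W) bop_pred bop_submod_closed.

Record bop := Bop { bop_fun :> V -> W; _ : bop_fun \in bop_pred }.

HB.instance Definition _ := [isSub for bop_fun].
HB.instance Definition _ := [Choice of bop by <:].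
HB.instance Definition _ := [SubChoice_isSubLmodule of bop by <:].

Lemma bopP (f : bop) : bounded_operator f.
Proof. exact/bop_predP/valP. Qed.

Lemma bop_linear (f : bop) : linear f.
Proof. by have [] := bopP f. Qed.

HB.instance Definition _ (f : bop) :=
  GRing.isLinear.Build R V W *:%R f (bop_linear f).

Lemma bop_ext (f g : bop) : (forall x, f x = g x) -> f = g.
Proof. by move=> fg; apply/val_inj/funext. Qed.

Definition opnorm (f : bop) : R := sup [set `|f x| | x in [set x | `|x| <= 1]].

Lemma opnorm_has_sup (f : bop) : has_sup [set `|f x| | x in [set x | `|x| <= 1]].
Proof.
split; first by exists `|f 0|, 0 => //=; rewrite normr0.
have [_ [M fM]] := bopP f; exists `|M| => _ [x /= x1 <-].
rewrite (le_trans (fM x))// (le_trans (ler_wpM2r _ (ler_norm M)))//.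
by rewrite ler_piMr.
Qed.

Lemma opnorm_ub (f : bop) x : `|x| <= 1 -> `|f x| <= opnorm f.
Proof. by move=> x1; apply: (sup_upper_bound (opnorm_has_sup f)); exists x. Qed.

Lemma opnorm_le (f : bop) M :
  (forall x, `|x| <= 1 -> `|f x| <= M) -> opnorm f <= M.
Proof.
move=> fM; apply: ge_sup; first by case: (opnorm_has_sup f).
by move=> _ [x x1 <-]; exact: fM.
Qed.

Lemma opnorm_ge0 (f : bop) : 0 <= opnorm f.
Proof. by rewrite (le_trans _ (@opnorm_ub f 0 _))// normr0. Qed.

Lemma opnormP (f : bop) x : `|f x| <= opnorm f * `|x|.
Proof.
have [->|x0] := eqVneq x 0; first by rewrite linear0 !normr0 mulr0.
have nx0 : 0 < `|x| by rewrite normr_gt0.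
rewrite -ler_pdivrMr//.
have := @opnorm_ub f (`|x|^-1 *: x).
rewrite linearZ !normrZ normfV normr_id mulVf ?gt_eqF// => /(_ (lexx _)).
by rewrite mulrC.
Qed.

Lemma opnormD (f g : bop) : opnorm (f + g) <= opnorm f + opnorm g.
Proof.
apply: opnorm_le => x x1; apply: (le_trans (ler_normD _ _)).
by rewrite lerD// opnorm_ub.
Qed.

Lemma opnormZ (a : R) (f : bop) : opnorm (a *: f) = `|a| * opnorm f.
Proof.
have le b g : opnorm (b *: g) <= `|b| * opnorm g.
  apply: opnorm_le => x x1; have -> : (b *: g) x = b *: g x by [].
  by rewrite normrZ ler_wpM2l// opnorm_ub.
apply/eqP; rewrite eq_le le /=.
have [->|a0] := eqVneq a 0; first by rewrite normr0 mul0r opnorm_ge0.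
rewrite -ler_pdivlMl ?normr_gt0// -normfV.
by have := le a^-1 (a *: f); rewrite scalerA mulVf// scale1r.
Qed.

Lemma opnorm0_eq0 (f : bop) : opnorm f = 0 -> f = 0.
Proof.
move=> f0; apply: bop_ext => x; apply/eqP; rewrite -normr_le0.
by rewrite (le_trans (opnormP f x))// f0 mul0r.
Qed.

HB.instance Definition _ :=
  @Lmodule_isNormed.Build R bop opnorm opnormD opnormZ opnorm0_eq0.

Lemma bop_normE (f : bop) : `|f| = opnorm f. Proof. by []. Qed.

End BoundedLinear.

Section Composition.
Context {R : realType}.

Lemma bop_id_subproof (V : normedModType R) : @bounded_operator R V V id.
Proof. by split=> //; exists 1 => x; rewrite mul1r. Qed.

Definition bop_id (V : normedModType R) : bop V V :=
  Bop (introT (bop_predP _) (bop_id_subproof V)).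

Lemma bop_comp_subproof (U V W : normedModType R) (g : bop V W) (f : bop U V) :
  bounded_operator (g \o f).
Proof.
split=> [a x y|]; first by rewrite /= !linearP.
exists (opnorm g * opnorm f) => x /=.
by rewrite (le_trans (opnormP _ _))// -mulrA ler_wpM2l ?opnorm_ge0 ?opnormP.
Qed.

Definition bop_comp (U V W : normedModType R) (g : bop V W) (f : bop U V) :
  bop U W := Bop (introT (bop_predP _) (bop_comp_subproof g f)).

Lemma bop_post_subproof (U V W : normedModType R) (g : bop V W) :
  bounded_operator (bop_comp g : bop U V -> bop U W).
Proof.
split=> [a f h|].
  by apply: bop_ext => x; rewrite /= linearP.
exists (opnorm g) => f; apply: opnorm_le => x x1 /=.
rewrite (le_trans (opnormP _ _))// ler_wpM2l ?opnorm_ge0//.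
exact: opnorm_ub.
Qed.

Definition bop_post (U V W : normedModType R) (g : bop V W) :
  bop (bop U V) (bop U W) :=
  Bop (introT (bop_predP _) (bop_post_subproof U g)).

End Composition.

Section HigherDerivatives.
Context {R : realType}.

(* The k-linear bounded maps V^k -> W in curried form, with the iterated
   operator norm; currying is isometric, so this norm is the usual norm of
   multilinear maps. *)
Fixpoint mlin (V W : normedModType R) (k : nat) : normedModType R :=
  if k is k'.+1 then bop V (mlin V W k') else W.

(* T |-> g o T on multilinear maps *)
Fixpoint mlin_post (V W Z : normedModType R) (g : bop W Z) (k : nat) :
  bop (mlin V W k) (mlin V Z k) :=
  if k is k'.+1 then bop_post V (mlin_post V g k') else g.

(* The Frechet derivative as an element of the space of bounded operators;
   it is 0 where 'd f x is not bounded, in particular it is only meaningful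
   at points of differentiability. *)
Definition fderiv (V W : normedModType R) (f : V -> W) (x : V) : bop V W :=
  insubd (0 : bop V W) ('d f x : V -> W).

Fixpoint fderivn (V W : normedModType R) (k : nat) (f : V -> W) :
  V -> mlin V W k :=
  if k is k'.+1 then fderiv (fderivn k' f) else f.

Definition Ck (V W : normedModType R) (U : set V) (k : nat) (f : V -> W) :=
  (forall i, (i < k)%N -> forall x, U x -> differentiable (fderivn i f) x) /\
  (forall i, (i <= k)%N -> forall x, U x -> {for x, continuous (fderivn i f)}).

(* d^(a+b) g / dl^a dx^b at (l, x) *)
Definition pderivn (E V W : normedModType R) (a b : nat) (g : E -> V -> W)
    (l : E) (x : V) : mlin E (mlin V W b) a :=
  fderivn a (fun l' => fderivn b (g l') x) l.

End HigherDerivatives.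

Section Cocycle.
Context {R : realType} {X : normedModType R}.
Variables A Ainv : int -> bop X X.

(* A_{n+j-1} ... A_n *)
Fixpoint cocycle_fwd (n : int) (j : nat) : bop X X :=
  if j is j'.+1 then bop_comp (A (n + j'%:Z)) (cocycle_fwd n j') else bop_id X.

(* A_{n-j}^-1 ... A_{n-1}^-1 *)
Fixpoint cocycle_bwd (n : int) (j : nat) : bop X X :=
  if j is j'.+1 then bop_comp (Ainv (n - j%:Z)) (cocycle_bwd n j')
  else bop_id X.

Definition cocycle (m n : int) : bop X X :=
  if n <= m then cocycle_fwd n `|m - n|%N else cocycle_bwd n `|n - m|%N.

Definition green (P : int -> bop X X) (m n : int) : bop X X :=
  if n <= m then bop_comp (cocycle m n) (P n)
  else - bop_comp (cocycle m n) (bop_id X - P n).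

Definition green_sum (P : int -> bop X X) (w : int -> R) : \bar R :=
  ereal_sup [set (\esum_(n in [set: int]) (w (n - 1) * `|green P m n|)%:E)%E
            | m in [set: int]].

End Cocycle.

(* Joint measurability of g : Z x X -> X, for the discrete sigma-algebra on Z,
   the Borel sigma-algebra on X and the product sigma-algebra on Z x X. *)
Definition measurable_ZX {R : realType} {X : normedModType R}
    (g : int -> X -> X) : Prop :=
  let borel := <<s [set U : set X | open U] >> in
  forall B : set X, borel B ->
    <<s [set N `*` U | N in [set: set int] & U in borel] >>
      [set p : int * X | B (g p.1 p.2)].

(* Main.v *)
(* Fix l0 in Sigma, weight sequences by om n = eps n + c n and put z = x - y and
   r_n = y_(n+1) - A_n y_n - f(l, n, y_n), so that z is a bounded solution of
   z_(n+1) = A_n z_n + f(l, n, x_n) - f(l, n, y_n) - r_n.  Having no bounded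
   homogeneous solution, a bounded sequence is the Green sum of its forcing;
   since q < 1, the equations v_(n+1) = (A_n + B_n) v_n + w_n with |B_n| <= c_n
   and w = O(om) therefore have exactly one bounded solution, with a uniform
   bound.  The same estimate makes z Lipschitz in l uniformly in n.  The only
   candidate z' for its derivative is the bounded solution of the linearized
   equation, and the Taylor remainders, which are O(om_n |h|^2) because all
   derivatives of order at least 2 are O(eps_n), show that z' is the derivative.
   The coefficients of the linearized equation depend on l through x only, so
   if x is of class C^j uniformly in n then so is z', and x is of class C^(j+1).

   Uniform C^j means that all derivatives up to order j are Lipschitz uniformly
   in n; a bound on the derivatives of order k+1 gives this only for j = k, which
   is where one derivative is lost.  The hypotheses bound the mixed partials of f
   in a single order of differentiation, and the symmetry of second derivatives
   turns this into a bound on the full derivative of f on E x X. *)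

Require Import Defs.
From mathcomp Require Import all_boot all_order all_algebra.
From mathcomp Require Import ring lra zify.
From mathcomp Require Import all_classical all_reals all_analysis.
Import Order.TTheory GRing.Theory Num.Theory.
Import numFieldNormedType.Exports.
Local Open Scope classical_set_scope.
Local Open Scope ring_scope.

Set Implicit Arguments.
Unset Strict Implicit.

(* Reflection for the [zmod] tactic below: two abelian group expressions are
   equal when every atom has the same integer coefficient in both. *)
Section ZmodNorm.

Inductive zexpr := ZAtom of nat | ZZero | ZAdd of zexpr & zexpr | ZOpp of zexpr.

Fixpoint zeval (V : zmodType) (env : seq V) (e : zexpr) : V :=
  match e with
  | ZAtom i => nth 0 env i
  | ZZero => 0
  | ZAdd a b => zeval env a + zeval env b
  | ZOpp a => - zeval env a
  end.

Fixpoint zcoef (e : zexpr) (i : nat) : int :=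
  match e with
  | ZAtom j => if i == j then 1 else 0
  | ZZero => 0
  | ZAdd a b => zcoef a i + zcoef b i
  | ZOpp a => - zcoef a i
  end.

Lemma zevalE (V : zmodType) (env : seq V) e :
  zeval env e = \sum_(i < size env) nth 0 env i *~ zcoef e i.
Proof.
elim: e => [j||a IHa b IHb|a IHa] /=.
- have [js|js] := ltnP j (size env).
    rewrite (bigD1 (Ordinal js))//= eqxx mulr1z big1 ?addr0// => i ij.
    have /negbTE-> : (i : nat) != j by [].
    by rewrite mulr0z.
  rewrite nth_default// big1// => i _.
  by rewrite ltn_eqF ?mulr0z// (leq_trans (ltn_ord i)).
- by rewrite big1// => i _; rewrite mulr0z.
- by rewrite IHa IHb -big_split; apply: eq_bigr => i _; rewrite mulrzDr.
- by rewrite IHa -sumrN; apply: eq_bigr => i _; rewrite mulrNz.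
Qed.

Lemma zmod_eq (V : zmodType) (env : seq V) (a b : zexpr) :
  all (fun i => zcoef a i == zcoef b i) (iota 0 (size env)) ->
  zeval env a = zeval env b.
Proof.
move=> /allP ab; rewrite !zevalE; apply: eq_bigr => i _; congr (_ *~ _).
apply/eqP; apply: ab; rewrite mem_iota add0n leq0n; exact: ltn_ord.
Qed.

End ZmodNorm.

Ltac zmod_find x l :=
  lazymatch l with
  | x :: _ => constr:(0%N)
  | _ :: ?l' => let n := zmod_find x l' in constr:(S n)
  end.
Ltac zmod_in x l :=
  lazymatch l with
  | nil => constr:(false)
  | x :: _ => constr:(true)
  | _ :: ?l' => zmod_in x l'
  end.
Ltac zmod_atoms t l :=
  lazymatch t with
  | (?a + ?b)%R => let l1 := zmod_atoms a l in zmod_atoms b l1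
  | (- ?a)%R => zmod_atoms a l
  | 0%R => l
  | _ => let m := zmod_in t l in
      lazymatch m with true => l | false => constr:(t :: l) end
  end.
Ltac zmod_quote t l :=
  lazymatch t with
  | (?a + ?b)%R => let a' := zmod_quote a l in let b' := zmod_quote b l in
      constr:(ZAdd a' b')
  | (- ?a)%R => let a' := zmod_quote a l in constr:(ZOpp a')
  | 0%R => constr:(ZZero)
  | _ => let n := zmod_find t l in constr:(ZAtom n)
  end.
Ltac zmod :=
  lazymatch goal with
  | |- @eq ?T ?a ?b =>
    let l0 := zmod_atoms a (@nil T) in
    let l := zmod_atoms b l0 in
    let a' := zmod_quote a l in
    let b' := zmod_quote b l in
    exact: (@zmod_eq _ l a' b' isT)
  end.

(** * Bounded operators and Frechet derivatives *)

Section Bop.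
Context {R : realType}.
Implicit Types V W : normedModType R.

Definition mkbop V W (f : V -> W) (bf : bounded_operator f) : bop V W :=
  Bop (introT (bop_predP f) bf).

Lemma bopD V W (f g : bop V W) v : (f + g) v = f v + g v. Proof. by []. Qed.
Lemma bopN V W (f : bop V W) v : (- f) v = - f v. Proof. by []. Qed.
Lemma bopB V W (f g : bop V W) v : (f - g) v = f v - g v. Proof. by []. Qed.
Lemma bopZ V W a (f : bop V W) v : (a *: f) v = a *: f v. Proof. by []. Qed.
Lemma bop0 V W v : (0 : bop V W) v = 0. Proof. by []. Qed.

Lemma bop_addr V W (f : bop V W) u v : f (u + v) = f u + f v.
Proof. exact: linearD. Qed.
Lemma bop_subr V W (f : bop V W) u v : f (u - v) = f u - f v.
Proof. exact: linearB. Qed.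
Lemma bop_oppr V W (f : bop V W) v : f (- v) = - f v.
Proof. exact: linearN. Qed.
Lemma bop_scaler V W (f : bop V W) a v : f (a *: v) = a *: f v.
Proof. exact: linearZ. Qed.

Lemma bop_le V W (f : bop V W) v : `|f v| <= `|f| * `|v|.
Proof. exact: opnormP. Qed.

Lemma bop_norm_le V W (f : bop V W) M :
  0 <= M -> (forall v, `|f v| <= M * `|v|) -> `|f| <= M.
Proof.
move=> M0 fM; apply: opnorm_le => v v1.
by rewrite (le_trans (fM v))// ler_piMr.
Qed.

Lemma bop_norm_small V W (f : bop V W) M d : 0 <= M -> 0 < d ->
  (forall v, `|v| < d -> `|f v| <= M * `|v|) -> `|f| <= M.
Proof.
move=> M0 d0 fM; apply: bop_norm_le => // v.
have [a a0 aE] : exists2 a, 0 < a & a = d / (2 * (`|v| + 1)).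
  by eexists; last reflexivity; apply: divr_gt0 => //; apply: mulr_gt0 => //; apply: ltr_wpDl.
have := fM (a *: v); rewrite bop_scaler !normrZ (gtr0_norm a0) mulrCA ler_pM2l//.
apply; rewrite aE mulrAC ltr_pdivrMr; last by apply: mulr_gt0 => //; apply: ltr_wpDl.
rewrite ltr_pM2l// mulrDr mulr1.
by have := normr_ge0 v; move: `|v| => r r0; lra.
Qed.

Lemma bop_comp_norm (U V W : normedModType R) (g : bop V W) (f : bop U V) :
  `|bop_comp g f| <= `|g| * `|f|.
Proof.
apply: bop_norm_le => [|v]; first by rewrite mulr_ge0.
by rewrite /= (le_trans (bop_le _ _))// -mulrA ler_wpM2l// bop_le.
Qed.

Lemma bop_id_norm V : `|bop_id V| <= 1.
Proof. by apply: bop_norm_le => // v; rewrite mul1r. Qed.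

Lemma bop_post_norm V W (Z : normedModType R) (g : bop W Z) : `|bop_post V g| <= `|g|.
Proof. by apply: bop_norm_le => // f; exact: bop_comp_norm. Qed.

End Bop.

(** * Frechet derivatives, mean value inequality and Taylor remainder *)

Section Derivative.
Context {R : realType}.
Implicit Types V W Z : normedModType R.

(** A relation with an explicit bounded operator: calculus rules produce witnesses and uniqueness
    compares them, without recourse to the default value of [fderiv]. *)
Definition is_fderiv V W (f : V -> W) (p : V) (L : bop V W) : Prop :=
  forall e : R, 0 < e -> exists2 d : R, 0 < d & forall q, `|q - p| < d ->
    `|f q - f p - L (q - p)| <= e * `|q - p|.

Lemma bounded_operator_continuous V W (f : {linear V -> W}) :
  bounded_operator f <-> continuous f.
Proof.
split=> [[_ [M fM]]|/linear_lipschitz[M _ fM]]; last by split; [exact: linearP|exists M].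
apply/linear_bounded_continuous/linear_boundedP; exists M; split.
  exact: num_real.
move=> r Mr x; rewrite (le_trans (fM x))// ler_wpM2r// ltW//.
Qed.

Lemma bop_continuous V W (f : bop V W) : continuous f.
Proof. by apply/bounded_operator_continuous/bopP. Qed.

Lemma is_fderivP V W (f : V -> W) p L : is_fderiv f p L <->
  differentiable f p /\ fderiv f p = L.
Proof.
split=> [fL|[df <-]].
  have fo : f \o shift p = cst (f p) + L +o_ 0 id.
    apply/eqaddoP => e e0; have [d d0 dP] := fL e e0.
    apply/nbhs_norm0P; exists d => // h /= hd.
    by have := dP (h + p); rewrite addrK !fctE opprD addrA; exact.
  have dfL := diff_unique (@bop_continuous _ _ L) fo.
  split.
    by apply/diff_locallyP; rewrite dfL; split => //; exact: bop_continuous.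
  apply: val_inj; rewrite /fderiv/= /insubd insubT; first by rewrite dfL; exact: valP.
  by move=> h; rewrite -dfL.
have df_bop : ('d f p : V -> W) \in @bop_pred R V W.
  exact/bop_predP/bounded_operator_continuous/diff_continuous.
have fdE : fderiv f p = 'd f p :> (V -> W) by rewrite /fderiv insubdK.
move=> e e0; have [_ /eqaddoP fo] := (diff_locallyP _ _).1 df.
have /nbhs_norm0P[d d0 dP] := fo e e0; exists d => // q qp.
have /(_ qp) := dP (q - p).
by rewrite !fctE/= subrK fdE opprD addrA.
Qed.

Lemma is_fderiv_unique V W (f : V -> W) p L L' :
  is_fderiv f p L -> is_fderiv f p L' -> L = L'.
Proof. by move=> /is_fderivP[_ <-] /is_fderivP[_ <-]. Qed.

Lemma fderivP V W (f : V -> W) p :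
  differentiable f p -> is_fderiv f p (fderiv f p).
Proof. by move=> fp; apply/is_fderivP. Qed.

Lemma open_ball V (U : set V) p : open U -> U p ->
  exists2 d : R, 0 < d & forall q, `|q - p| < d -> U q.
Proof.
move=> Uo Up; have /nbhs_normP[d d0 dU] : nbhs p U by rewrite nbhsE; exists U.
by exists d => // q qp; apply: dU; rewrite /ball_/= distrC.
Qed.

Lemma is_fderiv_ext V W (U : set V) (f g : V -> W) p L : open U -> U p ->
  (forall q, U q -> f q = g q) -> is_fderiv f p L -> is_fderiv g p L.
Proof.
move=> Uo Up fg fL e /fL[d d0 dP]; have [d' d'0 d'U] := open_ball Uo Up.
exists (Num.min d d'); first by rewrite lt_min d0.
move=> q; rewrite lt_min => /andP[qd qd']; rewrite -!fg//; last exact: d'U.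
exact: dP.
Qed.

Lemma is_fderiv_cst V W (w : W) p : is_fderiv (fun _ : V => w) p 0.
Proof.
by move=> e e0; exists 1 => // q _; rewrite subrr sub0r bop0 normrN normr0 mulr_ge0// ltW.
Qed.

Lemma is_fderiv_bop V W (f : bop V W) p : is_fderiv f p f.
Proof.
by move=> e e0; exists 1 => // q _; rewrite -bop_subr subrr normr0 mulr_ge0// ltW.
Qed.

Lemma is_fderivD V W (f g : V -> W) p L M :
  is_fderiv f p L -> is_fderiv g p M -> is_fderiv (fun x => f x + g x) p (L + M).
Proof.
move=> fL gM e e0; have e20 : 0 < e / 2 by rewrite divr_gt0.
have [d d0 dP] := fL _ e20; have [d' d'0 d'P] := gM _ e20.
exists (Num.min d d'); first by rewrite lt_min d0.
move=> q; rewrite lt_min => /andP[/dP fq /d'P gq].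
rewrite [e]splitr mulrDl bopD.
rewrite (_ : _ - _ = (f q - f p - L (q - p)) + (g q - g p - M (q - p))).
  by rewrite (le_trans (ler_normD _ _))// lerD.
by zmod.
Qed.

Lemma is_fderiv_lip V W (f : V -> W) p L : is_fderiv f p L ->
  exists2 d : R, 0 < d & forall q, `|q - p| < d ->
    `|f q - f p| <= (`|L| + 1) * `|q - p|.
Proof.
move=> /(_ _ ltr01)[d d0 dP]; exists d => // q /dP fq.
rewrite -[f q - f p](subrK (L (q - p))) (le_trans (ler_normD _ _))//.
by rewrite mulrDl addrC lerD// bop_le.
Qed.

Lemma is_fderiv_comp V W Z (g : W -> Z) (f : V -> W) p L M :
  is_fderiv f p L -> is_fderiv g (f p) M ->
  is_fderiv (g \o f) p (bop_comp M L).
Proof.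
move=> fL gM e e0; have [d d0 dP] := is_fderiv_lip fL.
(* [a] dominates [|M|] and the local Lipschitz constant [|L| + 1] of [f], so each of the two error
   terms below costs at most half of [e]. *)
pose a := `|M| + `|L| + 1.
have a0 : 0 < a by rewrite /a ltr_wpDl// addr_ge0.
have ea0 : 0 < e / 2 / a by rewrite !divr_gt0.
have [d1 d10 d1P] := fL _ ea0; have [d2 d20 d2P] := gM _ ea0.
exists (Num.min (Num.min d d1) (d2 / a)).
  by rewrite !lt_min d0 d10 divr_gt0.
move=> q; rewrite !lt_min => /andP[/andP[/dP fq /d1P fq1]].
rewrite ltr_pdivlMr// mulrC => qd2.
have fq' : `|f q - f p| <= a * `|q - p|.
  by rewrite (le_trans fq)// ler_wpM2r// /a -addrA lerDr.
have gq := d2P (f q) (le_lt_trans fq' qd2).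
rewrite [X in `|X|](_ : _ = (g (f q) - g (f p) - M (f q - f p)) +
   M (f q - f p - L (q - p))); last by rewrite /= !bop_subr; zmod.
rewrite (le_trans (ler_normD _ _))// [leRHS](_ : _ = e / 2 * `|q - p| + e / 2 * `|q - p|).
  rewrite lerD//.
    rewrite (le_trans gq)// (le_trans (ler_wpM2l _ fq'))//.
      by rewrite divr_ge0 ?divr_ge0// ltW.
    by rewrite mulrA divfK// gt_eqF.
  rewrite (le_trans (bop_le _ _))// (le_trans (ler_wpM2l _ fq1))// mulrA ler_wpM2r//.
  rewrite mulrA ler_pdivrMr// (mulrC `|M|) ler_wpM2l ?divr_ge0 ?(ltW e0)//.
  by rewrite /a -addrA lerDl addr_ge0.
by rewrite -mulrDl -splitr.
Qed.

Lemma is_fderiv_linear V W Z (M : bop W Z) (f : V -> W) p L :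
  is_fderiv f p L -> is_fderiv (fun x => M (f x)) p (bop_comp M L).
Proof. by move=> fL; exact: (is_fderiv_comp fL (is_fderiv_bop M (f p))). Qed.

Lemma is_fderivN V W (f : V -> W) p L :
  is_fderiv f p L -> is_fderiv (fun x => - f x) p (- L).
Proof.
move=> /(is_fderiv_linear (- bop_id W)).
by congr (is_fderiv _ _ _); exact: bop_ext.
Qed.

Lemma is_fderivB V W (f g : V -> W) p L M :
  is_fderiv f p L -> is_fderiv g p M -> is_fderiv (fun x => f x - g x) p (L - M).
Proof. by move=> fL /is_fderivN; exact: is_fderivD. Qed.

Definition segment_closed V (U : set V) := forall p q (t : R),
  U p -> U q -> 0 <= t <= 1 -> U (p + t *: (q - p)).

Lemma norm_segment V (p u v : V) (t : R) : 0 <= t <= 1 ->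
  `|u + t *: (v - u) - p| <= (1 - t) * `|u - p| + t * `|v - p|.
Proof.
move=> /andP[t0 t1]; rewrite (_ : _ - p = (1 - t) *: (u - p) + t *: (v - p)).
  by rewrite (le_trans (ler_normD _ _))// !normrZ (ger0_norm t0) ger0_norm ?subr_ge0.
by rewrite scalerBl scale1r !scalerBr; zmod.
Qed.

Lemma segment_closed_cball V (p : V) r : segment_closed [set v | `|v - p| <= r].
Proof.
move=> u v t /= up vp t01; rewrite (le_trans (norm_segment p u v t01))//.
have /andP[t0 t1] := t01.
rewrite (le_trans (lerD (ler_wpM2l _ up) (ler_wpM2l _ vp)))// ?subr_ge0//.
by rewrite -mulrDl subrK mul1r.
Qed.

Lemma segment_closedI V (A B : set V) :
  segment_closed A -> segment_closed B -> segment_closed (A `&` B).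
Proof.
by move=> Ac Bc p q t [Ap Bp] [Aq Bq] t01; split; [exact: Ac|exact: Bc].
Qed.

(** By completeness of the reals: the supremum of the times [t] with [|g t - g 0| <= (M + e) * t]
    satisfies this bound itself, and if it were below 1 the local bound there would push it
    further. *)
Lemma local_slope_bound W (g : R -> W) (M : R) :
  (forall t, 0 <= t <= 1 -> forall e : R, 0 < e ->
    exists2 d : R, 0 < d & forall u, 0 <= u <= 1 -> `|u - t| < d ->
      `|g u - g t| <= (M + e) * `|u - t|) ->
  `|g 1 - g 0| <= M.
Proof.
move=> gM; apply/ler_addgt0Pr => e e0.
pose S := [set t : R | 0 <= t <= 1 /\ `|g t - g 0| <= (M + e) * t].
have S0 : S 0 by split; rewrite ?lexx ?ler01// subrr normr0 mulr0.
have Sb : has_sup S.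
  by split; [exists 0|exists 1 => t [/andP[]]].
pose s := sup S.
have s01 : 0 <= s <= 1.
  apply/andP; split; first by apply: (sup_upper_bound Sb).
  by apply: ge_sup; [exists 0|move=> t [/andP[]]].
have [s0 s1] := andP s01.
have [d d0 dP] := gM s s01 e e0.
have Ss : S s.
  split=> //; have [t St sdt] := sup_adherent d0 Sb.
  have [t01 gt] := St.
  have ts : t <= s by apply: (sup_upper_bound Sb).
  have st : `|g t - g s| <= (M + e) * (s - t).
    rewrite -[s - t]ger0_norm ?subr_ge0// (distrC s); apply: dP => //.
    by rewrite distrC ger0_norm ?subr_ge0//; move: sdt; rewrite -/s; lra.
  rewrite (_ : g s - g 0 = (g t - g 0) - (g t - g s)); last by zmod.
  rewrite (le_trans (ler_normB _ _))// (le_trans (lerD gt st))//.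
  by rewrite -mulrDr subrKC.
have [s1'|s1'] := ltP s 1; last first.
  have : s = 1 by apply/eqP; rewrite eq_le s1.
  by move=> sE; have [_] := Ss; rewrite sE mulr1.
pose u := Num.min 1 (s + d / 2).
have su : s < u by rewrite /u lt_min s1' ltrDl divr_gt0.
have ud : u - s < d.
  rewrite (le_lt_trans (_ : _ <= d / 2))//; last by lra.
  by rewrite lerBlDr addrC /u ge_min lexx orbT.
have Su : S u.
  split; first by rewrite (le_trans s0 (ltW su))/= /u ge_min lexx.
  have ut : `|g u - g s| <= (M + e) * (u - s).
    rewrite -[u - s]gtr0_norm ?subr_gt0//; apply: dP.
      by rewrite (le_trans s0 (ltW su))/= /u ge_min lexx.
    by rewrite gtr0_norm ?subr_gt0.
  rewrite (_ : g u - g 0 = (g u - g s) + (g s - g 0)); last by zmod.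
  rewrite (le_trans (ler_normD _ _))// (le_trans (lerD ut Ss.2))//.
  by rewrite -mulrDr subrK.
by have := sup_upper_bound Sb Su; rewrite leNgt su.
Qed.

(** The restriction of [f] to the segment from [p] to [q] has local slope at most [K * |q - p|],
    which reduces the claim to one real variable. *)
Lemma mean_value_ineq V W (U : set V) (f : V -> W) (L : V -> bop V W) (K : R) :
  segment_closed U -> (forall p, U p -> is_fderiv f p (L p)) ->
  (forall p, U p -> `|L p| <= K) ->
  forall p q, U p -> U q -> `|f q - f p| <= K * `|q - p|.
Proof.
move=> Uc fL LK p q Up Uq.
pose g t := f (p + t *: (q - p)).
have -> : f q - f p = g 1 - g 0.
  by rewrite /g scale1r scale0r addr0 subrKC.
apply: local_slope_bound => t t01 e e0.
have e'0 : 0 < e / (`|q - p| + 1) by rewrite divr_gt0// ltr_wpDl.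
have [d d0 dP] := fL _ (Uc _ _ _ Up Uq t01) _ e'0.
exists (d / (`|q - p| + 1)); first by rewrite divr_gt0// ltr_wpDl.
move=> u u01; rewrite ltr_pdivlMr ?ltr_wpDl// => utd.
have E : p + u *: (q - p) - (p + t *: (q - p)) = (u - t) *: (q - p).
  by rewrite opprD addrACA subrr add0r scalerBl.
have := dP (p + u *: (q - p)); rewrite E normrZ => Hd.
have {}Hd : `|f (p + u *: (q - p)) - f (p + t *: (q - p)) -
    L (p + t *: (q - p)) ((u - t) *: (q - p))| <= e / (`|q - p| + 1) * (`|u - t| * `|q - p|).
  by apply: Hd; apply: le_lt_trans utd; rewrite ler_wpM2l// lerDl.
rewrite -[g u - g t](subrK (L (p + t *: (q - p)) ((u - t) *: (q - p)))).
rewrite (le_trans (ler_normD _ _))// mulrDl addrC lerD//.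
  rewrite (le_trans (bop_le _ _))// normrZ mulrCA mulrC ler_wpM2r//.
  by rewrite ler_wpM2r// LK//; exact: Uc.
rewrite (le_trans Hd)// mulrCA mulrC ler_wpM2r// mulrAC ler_pdivrMr ?ltr_wpDl//.
by rewrite ler_wpM2l ?ltW// ltrDl.
Qed.

(** Subtracting the linear map [L p] leaves a function whose derivative [L v - L p] is at most
    [K * |q - p|] on the part of [U] within distance [|q - p|] of [p]; the mean value inequality
    applies there. *)
Lemma taylor1 V W (U : set V) (f : V -> W) (L : V -> bop V W) (K : R) :
  segment_closed U -> (forall p, U p -> is_fderiv f p (L p)) -> 0 <= K ->
  (forall p q, U p -> U q -> `|L q - L p| <= K * `|q - p|) ->
  forall p q, U p -> U q ->
  `|f q - f p - L p (q - p)| <= K * `|q - p| ^+ 2.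
Proof.
move=> Uc fL K0 LK p q Up Uq.
pose B := [set v | U v /\ `|v - p| <= `|q - p|].
have Bc : segment_closed B by exact: segment_closedI (@segment_closed_cball _ _ _).
have := @mean_value_ineq _ _ B (fun v => f v - L p v) (fun v => L v - L p) (K * `|q - p|) Bc.
rewrite expr2 mulrA bop_subr => H.
rewrite (_ : _ - _ = (f q - L p q) - (f p - L p p)); last by zmod.
apply: H => //.
- by move=> v [Uv vp]; apply: is_fderivB (is_fderiv_bop (L p) v); exact: fL.
- by move=> v [Uv vp]; rewrite (le_trans (LK _ _ Up Uv))// ler_wpM2l.
- by split=> //; rewrite subrr normr0.
Qed.

End Derivative.

(** * Equidifferentiable families *)

Section Families.
Context {R : realType}.
Implicit Types V W Z : normedModType R.

Lemma ler_normD2 V (a b : V) (x y : R) :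
  `|a| <= x -> `|b| <= y -> `|a + b| <= x + y.
Proof. by move=> ax bY; rewrite (le_trans (ler_normD _ _))// lerD. Qed.

Lemma ler_normB2 V (a b : V) (x y : R) :
  `|a| <= x -> `|b| <= y -> `|a - b| <= x + y.
Proof. by move=> ax bY; rewrite (le_trans (ler_normB _ _))// lerD. Qed.

Definition bilinear_bounded W1 W2 Z (B : W1 -> W2 -> Z) (C : R) :=
  [/\ 0 <= C, forall a, linear (B a), forall w, linear (B ^~ w) &
      forall a w, `|B a w| <= C * `|a| * `|w|].

Lemma bilin_right_bounded W1 W2 Z (B : W1 -> W2 -> Z) C a :
  bilinear_bounded B C -> bounded_operator (B a).
Proof. by move=> [_ Br _ BC]; split=> //; exists (C * `|a|) => w; exact: BC. Qed.

Lemma bilin_left_bounded W1 W2 Z (B : W1 -> W2 -> Z) C w :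
  bilinear_bounded B C -> bounded_operator (B ^~ w).
Proof.
by move=> [_ _ Bl BC]; split=> //; exists (C * `|w|) => a; rewrite mulrAC BC.
Qed.

(** The product rule: the error splits into the remainder of [u] against [w q], the linear increment
    of [u] against the increment of [w], and [u p] against the remainder of [w]. *)
Lemma is_fderiv_bilin V W1 W2 Z (B : W1 -> W2 -> Z) C (bB : bilinear_bounded B C)
    (u : V -> W1) (w : V -> W2) p L M :
  is_fderiv u p L -> is_fderiv w p M ->
  is_fderiv (fun q => B (u q) (w q)) p
    (bop_comp (mkbop (bilin_left_bounded (w p) bB)) L +
     bop_comp (mkbop (bilin_right_bounded (u p) bB)) M).
Proof.
have [C0 Br Bl BC] := bB => uL wM.
have BrB a x y : B a (x - y) = B a x - B a y.
  by rewrite -(scaleN1r y) addrC Br scaleN1r addrC.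
have BlB a x y : B (x - y) a = B x a - B y a.
  by rewrite -(scaleN1r y) addrC Bl scaleN1r addrC.
have [d0 d00 d0P] := is_fderiv_lip wM.
pose N := 1 + `|w p| + `|M| + `|u p| + `|L|.
have N1 : 1 <= N by rewrite /N -!addrA lerDl !addr_ge0.
have N0 : 0 < N by exact: lt_le_trans N1.
have C1 : 0 < C + 1 by rewrite ltr_wpDl.
move=> e e0.
(* Each of the three error terms will be at most [C * N * e1 * |q - p|]; [C + 1] replaces [C]
   because [C] may be zero. *)
have [e1 e10 e1E] : exists2 e1, 0 < e1 & e1 * (C + 1) * N * 3 = e.
  exists (e / ((C + 1) * N * 3)).
    by rewrite !(divr_gt0, mulr_gt0).
  by rewrite -!mulrA mulVf ?mulr1// gt_eqF// !mulr_gt0.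
have [d1 d10 d1P] := uL _ e10; have [d2 d20 d2P] := wM _ e10.
exists (Num.min (Num.min d0 d1) (Num.min d2 (Num.min 1 (e1 / N)))).
  by rewrite !lt_min d00 d10 d20 ltr01 divr_gt0.
move=> q; rewrite !lt_min -andbA => /and5P[/d0P wl /d1P ul /d2P wl2 q1 qe].
rewrite bopD /= (_ : _ - _ = B (u q - u p - L (q - p)) (w q) +
  B (L (q - p)) (w q - w p) + B (u p) (w q - w p - M (q - p))); last first.
  by rewrite !BlB !BrB; zmod.
have h0 := normr_ge0 (q - p).
have wq : `|w q| <= N.
  rewrite -[w q](subrK (w p)) (le_trans (ler_normD _ _))//.
  rewrite (le_trans (lerD wl (lexx _)))//.
  have Mq : (`|M| + 1) * `|q - p| <= `|M| + 1.
    by rewrite ler_piMr ?addr_ge0// ltW.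
  rewrite (le_trans (lerD Mq (lexx _)))// /N.
  have := normr_ge0 (u p); have := normr_ge0 L.
  by move: `|w p| `|M| `|u p| `|L| => *; lra.
have T1 : `|B (u q - u p - L (q - p)) (w q)| <= C * N * e1 * `|q - p|.
  rewrite (le_trans (BC _ _))// -!mulrA ler_wpM2l//.
  by rewrite mulrC ler_pM.
have T2 : `|B (L (q - p)) (w q - w p)| <= C * N * e1 * `|q - p|.
  rewrite (le_trans (BC _ _))// -!mulrA ler_wpM2l//.
  have Le : `|L (q - p)| <= N * `|q - p|.
    rewrite (le_trans (bop_le _ _))// ler_wpM2r// /N lerDr.
    by rewrite !addr_ge0.
  have we : `|w q - w p| <= e1.
    rewrite (le_trans wl)// (le_trans (ler_wpM2l _ (ltW qe))) ?addr_ge0//.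
    rewrite mulrCA ger_pMr// ler_pdivrMr// mul1r /N.
    have := normr_ge0 (u p); have := normr_ge0 L; have := normr_ge0 (w p).
    by move: `|w p| `|M| `|u p| `|L| => *; lra.
  rewrite (le_trans (ler_pM _ _ Le we))// -mulrA ler_wpM2l ?(ltW N0)//.
  by rewrite mulrC.
have T3 : `|B (u p) (w q - w p - M (q - p))| <= C * N * e1 * `|q - p|.
  rewrite (le_trans (BC _ _))// -!mulrA ler_wpM2l// ler_pM// /N.
  have := normr_ge0 (w p); have := normr_ge0 L; have := normr_ge0 M.
  by move: `|w p| `|M| `|u p| `|L| => *; lra.
rewrite (le_trans (ler_normD2 (ler_normD2 T1 T2) T3))//.
rewrite -!mulrDl ler_wpM2r// -e1E.
have : 0 <= N * e1 by rewrite mulr_ge0// ltW.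
rewrite -(mulrA _ N) (_ : e1 * (C + 1) * N * 3 = (C + 1) * (N * e1) * 3); last by ring.
by move: (N * e1) => x x0; nra.
Qed.

Variable b : bool.

(* [b] switches the uniform estimates on: with [b = false] the class [equiC]
   below only records repeated differentiability. *)
Definition equi_lip I V W (U : set V) (u : I -> V -> W) :=
  b -> exists2 K : R, 0 <= K & forall i p q, U p -> U q ->
    `|u i q - u i p| <= K * `|q - p|.

Definition equi_bdd I V W (U : set V) (u : I -> V -> W) :=
  b -> exists2 K : R, 0 <= K & forall i p, U p -> `|u i p| <= K.

(** For [b = true]: class C^k with Lipschitz constants independent of the index for all derivatives
    up to order [k]. The derivatives are existential witnesses and the codomain changes along the
    recursion, so closure properties go by induction on [k] over all codomains at once. *)
Fixpoint equiC (I : Type) (V : normedModType R) (U : set V) (k : nat)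
    (W : normedModType R) (u : I -> V -> W) {struct k} : Prop :=
  equi_lip U u /\ match k with
  | 0%N => True
  | k'.+1 => exists u' : I -> V -> bop V W,
      (forall i p, U p -> is_fderiv (u i) p (u' i p)) /\ equiC U k' u'
  end.

Lemma equiC_lip I V W (U : set V) k (u : I -> V -> W) :
  equiC U k u -> equi_lip U u.
Proof. by case: k => [|k] []. Qed.

Lemma equiCS I V W (U : set V) k (u : I -> V -> W) : equiC U k.+1 u <->
  equi_lip U u /\ exists u' : I -> V -> bop V W,
    (forall i p, U p -> is_fderiv (u i) p (u' i p)) /\ equiC U k u'.
Proof. by []. Qed.

Lemma equiC_weak I V (U : set V) k W (u : I -> V -> W) :
  equiC U k.+1 u -> equiC U k u.
Proof.
elim: k W u => [|k IH] W u; first by move=> [].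
by move=> /equiCS[ul [u' [uu' u'C]]]; split=> //; exists u'; split=> //; exact: IH.
Qed.

Lemma equiC_le I V (U : set V) k m W (u : I -> V -> W) :
  (k <= m)%N -> equiC U m u -> equiC U k u.
Proof.
move=> /subnKC <-; elim: (m - k)%N => [|n IH]; first by rewrite addn0.
by rewrite addnS => /equiC_weak.
Qed.

Lemma equi_lip_ext I V W (U : set V) (u v : I -> V -> W) :
  (forall i p, U p -> u i p = v i p) -> equi_lip U u -> equi_lip U v.
Proof.
move=> uv uL /uL[K K0 KP]; exists K => // i p q Up Uq.
by rewrite -!uv//; exact: KP.
Qed.

Lemma equiC_ext I V W (U : set V) k (u v : I -> V -> W) : open U ->
  (forall i p, U p -> u i p = v i p) -> equiC U k u -> equiC U k v.
Proof.
case: k => [|k] Uo uv; first by move=> [ul _]; split=> //; exact: equi_lip_ext ul.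
move=> [ul [u' [uu' u'C]]]; split; first exact: equi_lip_ext ul.
exists u'; split=> // i p Up.
by apply: (is_fderiv_ext Uo Up (uv i)); exact: uu'.
Qed.

Lemma equiC_cst I V (U : set V) k W (w : I -> W) : equiC U k (fun i (_ : V) => w i).
Proof.
have L W' (w' : I -> W') : equi_lip U (fun i (_ : V) => w' i).
  by move=> _; exists 0 => // *; rewrite subrr normr0 mul0r.
elim: k W w => [|k IH] W w //=; split=> //.
exists (fun _ _ => 0); split; last exact: (IH _ (fun=> 0)).
by move=> i p _; exact: is_fderiv_cst.
Qed.

Lemma equiCD I V (U : set V) k W (u v : I -> V -> W) :
  equiC U k u -> equiC U k v -> equiC U k (fun i p => u i p + v i p).
Proof.
have L W' (u' v' : I -> V -> W') : equi_lip U u' -> equi_lip U v' ->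
    equi_lip U (fun i p => u' i p + v' i p).
  move=> uL vL bT; have [K K0 KP] := uL bT; have [M M0 MP] := vL bT.
  exists (K + M); first by rewrite addr_ge0.
  move=> i p q Up Uq; rewrite opprD addrACA mulrDl.
  by apply: ler_normD2; [exact: KP|exact: MP].
elim: k W u v => [|k IH] W u v.
  by move=> [ul _] [vl _]; split=> //; exact: L.
move=> /equiCS[ul [u' [uu' u'C]]] /equiCS[vl [v' [vv' v'C]]]; split; first exact: L.
exists (fun i p => u' i p + v' i p); split; last exact: IH.
by move=> i p Up; apply: is_fderivD; [exact: uu'|exact: vv'].
Qed.

Lemma equiC_linear I V (U : set V) k W Z (M : I -> bop W Z) (u : I -> V -> W) :
  (b -> exists2 K : R, 0 <= K & forall i, `|M i| <= K) ->
  equiC U k u -> equiC U k (fun i p => M i (u i p)).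
Proof.
elim: k W Z M u => [|k IH] W Z M u Mb.
  move=> [uL _]; split=> // bT; have [K K0 KP] := uL bT; have [N N0 NP] := Mb bT.
  exists (N * K); first by rewrite mulr_ge0.
  move=> i p q Up Uq; rewrite -bop_subr (le_trans (bop_le _ _))// -mulrA.
  by rewrite ler_pM// KP.
move=> /equiCS[ul [u' [uu' u'C]]]; split.
  move=> bT; have [K K0 KP] := ul bT; have [N N0 NP] := Mb bT.
  exists (N * K); first by rewrite mulr_ge0.
  move=> i p q Up Uq; rewrite -bop_subr (le_trans (bop_le _ _))// -mulrA.
  by rewrite ler_pM// KP.
exists (fun i p => bop_comp (M i) (u' i p)); split.
  by move=> i p Up; apply: is_fderiv_linear; exact: uu'.
apply: (IH _ _ (fun i => bop_post V (M i))) => // bT.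
have [N N0 NP] := Mb bT; exists N => // i; apply: bop_norm_le => // f.
by rewrite (le_trans (bop_comp_norm _ _))// ler_wpM2r.
Qed.

Lemma equiCN I V (U : set V) k W (u : I -> V -> W) :
  equiC U k u -> equiC U k (fun i p => - u i p).
Proof.
apply: (equiC_linear (M := fun=> - bop_id W)) => _; exists 1 => // _.
by rewrite normrN bop_id_norm.
Qed.

Lemma equiC_bop I V (U : set V) k W (M : I -> bop V W) :
  (b -> exists2 K : R, 0 <= K & forall i, `|M i| <= K) ->
  equiC U k (fun i p => M i p).
Proof.
move=> Mb; have ML : equi_lip U (fun i p => M i p).
  move=> /Mb[K K0 MK]; exists K => // i p q _ _.
  by rewrite -bop_subr (le_trans (bop_le _ _))// ler_wpM2r.
case: k => [|k]; first by split.
apply/equiCS; split=> //; exists (fun i _ => M i); split.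
  by move=> i p _; exact: is_fderiv_bop.
exact: equiC_cst.
Qed.

(** A converse of the mean value inequality: for small [v], [L v] is an increment of [f] minus a
    remainder of size at most [e * |v|]. *)
Lemma is_fderiv_norm_le V W (U : set V) (f : V -> W) p L K : open U -> U p ->
  0 <= K -> is_fderiv f p L ->
  (forall q, U q -> `|f q - f p| <= K * `|q - p|) -> `|L| <= K.
Proof.
move=> Uo Up K0 fL fK; apply/ler_addgt0Pr => e e0.
have [d d0 dP] := fL e e0; have [d' d'0 d'U] := open_ball Uo Up.
apply: (@bop_norm_small _ _ _ _ _ (Num.min d d')).
- by rewrite addr_ge0// ltW.
- by rewrite lt_min d0.
move=> v; rewrite lt_min => /andP[vd vd'].
have := dP (v + p); rewrite addrK => /(_ vd) H.
have := fK (v + p); rewrite addrK => /(_ (d'U _ _)); rewrite addrK => /(_ vd') H2.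
rewrite (_ : L v = (f (v + p) - f p) - (f (v + p) - f p - L v)); last by zmod.
by rewrite mulrDl; exact: ler_normB2.
Qed.

Lemma equi_lip_deriv_bdd I V W (U : set V) (u : I -> V -> W) u' : open U ->
  equi_lip U u -> (forall i p, U p -> is_fderiv (u i) p (u' i p)) ->
  equi_bdd U u'.
Proof.
move=> Uo uL uu' /uL[K K0 KP]; exists K => // i p Up.
by apply: (is_fderiv_norm_le Uo Up K0 (uu' i p Up)) => q Uq; exact: KP.
Qed.

(** Boundedness of [u] and [w] makes their product Lipschitz. The derivative is a sum of two
    products in which one factor is a derivative, bounded by the Lipschitz constant of its
    primitive; so the induction hypothesis applies to [B1] and [B2]. *)
Lemma equiC_bilin I V (U : set V) k W1 W2 Z (B : W1 -> W2 -> Z) C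
    (u : I -> V -> W1) (w : I -> V -> W2) : open U -> bilinear_bounded B C ->
  equiC U k u -> equiC U k w -> equi_bdd U u -> equi_bdd U w ->
  equiC U k (fun i p => B (u i p) (w i p)).
Proof.
move=> Uo.
have L W1' W2' Z' (B' : W1' -> W2' -> Z') C' u' w' : bilinear_bounded B' C' ->
    equi_lip U u' -> equi_lip U w' -> equi_bdd U u' -> equi_bdd U w' ->
    equi_lip U (fun i p => B' (u' i p) (w' i p) : Z').
  move=> [C0 Br Bl BC] uL wL ub wb bT.
  have [K K0 KP] := uL bT; have [M M0 MP] := wL bT.
  have [K' K'0 K'P] := ub bT; have [M' M'0 M'P] := wb bT.
  exists (C' * (K * M' + K' * M)).
    by rewrite mulr_ge0// addr_ge0// mulr_ge0.
  move=> i p q Up Uq.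
  have BrB a x y : B' a (x - y) = B' a x - B' a y.
    by rewrite -(scaleN1r y) addrC Br scaleN1r addrC.
  have BlB a x y : B' (x - y) a = B' x a - B' y a.
    by rewrite -(scaleN1r y) addrC Bl scaleN1r addrC.
  rewrite (_ : _ - _ = B' (u' i q - u' i p) (w' i q) +
    B' (u' i p) (w' i q - w' i p)); last first.
    by rewrite BlB BrB; zmod.
  rewrite -mulrA mulrDl mulrDr; apply: ler_normD2.
    rewrite (le_trans (BC _ _))// -!mulrA ler_wpM2l// mulrA mulrAC ler_pM//.
      by rewrite KP.
    exact: M'P.
  rewrite (le_trans (BC _ _))// -!mulrA ler_wpM2l// ler_pM//.
    exact: K'P.
  exact: MP.
elim: k W1 W2 Z B C u w => [|k IH] W1 W2 Z B C u w bB.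
  by move=> [uL _] [wL _] ub wb; split=> //; exact: L bB uL wL ub wb.
move=> /[dup] uC1 /equiCS[ul [u' [uu' u'C]]] /[dup] wC1 /equiCS[wl [w' [ww' w'C]]] ub wb.
split; first exact: (L _ _ _ _ B C _ _ bB ul wl ub wb).
have u'b := equi_lip_deriv_bdd Uo ul uu'; have w'b := equi_lip_deriv_bdd Uo wl ww'.
eexists; split.
  move=> i p Up; exact: (is_fderiv_bilin bB (uu' i p Up) (ww' i p Up)).
have [C0 Br Bl BC] := bB.
apply: equiCD.
  pose B1 (a : bop V W1) x := bop_comp (mkbop (bilin_left_bounded x bB)) a.
  apply: (IH _ _ _ B1 C) => //; last exact: equiC_weak.
  split=> //.
  - by move=> a c x y; apply: bop_ext => h; rewrite /= Br.
  - by move=> x c y z; apply: bop_ext => h; rewrite /= Bl.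
  - move=> a x; apply: bop_norm_le => [|h]; first by rewrite !mulr_ge0.
    rewrite (le_trans (BC _ _))// [leRHS]mulrAC ler_wpM2r// -mulrA ler_wpM2l//.
    exact: bop_le.
pose B2 x (a : bop V W2) := bop_comp (mkbop (bilin_right_bounded x bB)) a.
apply: (IH _ _ _ B2 C) => //; last exact: equiC_weak.
split=> //.
- by move=> x c y z; apply: bop_ext => h; rewrite /= Br.
- by move=> a c x y; apply: bop_ext => h; rewrite /= Bl.
- move=> x a; apply: bop_norm_le => [|h]; first by rewrite !mulr_ge0.
  by rewrite (le_trans (BC _ _))// -!mulrA ler_wpM2l// ler_wpM2l// bop_le.
Qed.

Lemma bop_comp_bilinear (X1 X2 X3 : normedModType R) :
  bilinear_bounded (@bop_comp R X1 X2 X3) 1.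
Proof.
split=> //.
- by move=> g c x y; apply: bop_ext => h; rewrite /= bop_addr bop_scaler.
- by move=> w c f g; exact: bop_ext.
- by move=> f g; rewrite mul1r bop_comp_norm.
Qed.

Lemma bop_eval_bilinear (X1 X2 : normedModType R) :
  bilinear_bounded (fun (f : bop X1 X2) x => f x) 1.
Proof.
split=> //.
- by move=> g c x y; rewrite bop_addr bop_scaler.
- by move=> f x; rewrite mul1r bop_le.
Qed.

(** The derivative is the product, under [bop_comp], of [g'] along [u] with [u']: the first factor
    is covered by induction, and both are bounded as derivatives of Lipschitz maps. *)
Lemma equiC_comp I V W Z (U : set V) (D : set W) k (g : I -> W -> Z) (u : I -> V -> W) :
  open U -> open D -> (forall i p, U p -> D (u i p)) ->
  equiC D k g -> equiC U k u -> equiC U k (fun i p => g i (u i p)).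
Proof.
move=> Uo Do UD.
have L Z' (g' : I -> W -> Z') : equi_lip D g' -> equi_lip U u ->
    equi_lip U (fun i p => g' i (u i p)).
  move=> gL uL bT; have [K K0 KP] := uL bT; have [M M0 MP] := gL bT.
  exists (M * K); first by rewrite mulr_ge0.
  move=> i p q Up Uq; rewrite (le_trans (MP _ _ _ _ _))//; [exact: UD|exact: UD|].
  by rewrite -mulrA ler_wpM2l// KP.
elim: k Z g => [|k IH] Z g gC uC.
  by split=> //; apply: L; [exact: equiC_lip gC|exact: equiC_lip uC].
have /equiCS[gl [g' [gg' g'C]]] := gC; have /equiCS[ul [u' [uu' u'C]]] := uC.
split; first exact: L.
exists (fun i p => bop_comp (g' i (u i p)) (u' i p)); split.
  by move=> i p Up; apply: is_fderiv_comp; [exact: uu'|apply: gg'; exact: UD].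
apply: (@equiC_bilin _ _ U k _ _ _ _ 1 (fun i p => g' i (u i p))) => //.
- exact: bop_comp_bilinear.
- by apply: IH => //; exact: equiC_weak.
- have g'b := equi_lip_deriv_bdd Do gl gg'.
  by move=> /g'b[K K0 KP]; exists K => // i p Up; apply: KP; exact: UD.
- exact: equi_lip_deriv_bdd uu'.
Qed.

End Families.

(** * Iterated derivatives *)

Section HigherOrder.
Context {R : realType}.
Implicit Types V W Z : normedModType R.

Definition smooth_on V W (U : set V) (k : nat) (f : V -> W) :=
  forall j, (j < k)%N -> forall p, U p ->
    is_fderiv (fderivn j f) p (fderivn j.+1 f p).

Lemma smooth_onP V W (U : set V) k (f : V -> W) : smooth_on U k f <->
  (forall j, (j < k)%N -> forall p, U p -> differentiable (fderivn j f) p).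
Proof.
split=> H j jk p Up; first by have [] := (is_fderivP _ _ _).1 (H j jk p Up).
by apply: fderivP; exact: H.
Qed.

Lemma smooth_on_le V W (U : set V) k m (f : V -> W) :
  (k <= m)%N -> smooth_on U m f -> smooth_on U k f.
Proof. by move=> km fm j jk; apply: fm; exact: leq_trans km. Qed.

(** Iterated derivatives are identified by exhibiting a tower [d] in which each level differentiates
    the one below; [U] being open, equality on [U] passes to derivatives. *)
Lemma fderivn_tower V W (U : set V) k (f : V -> W)
    (d : forall j, V -> mlin V W j) : open U ->
  (forall p, U p -> f p = d 0%N p) ->
  (forall j, (j < k)%N -> forall p, U p -> is_fderiv (d j) p (d j.+1 p)) ->
  smooth_on U k f /\
  forall j, (j <= k)%N -> forall p, U p -> fderivn j f p = d j p.
Proof.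
move=> Uo fd dd.
have E j : (j <= k)%N -> forall p, U p -> fderivn j f p = d j p.
  elim: j => [|j IH] jk p Up; first exact: fd.
  have /is_fderivP[_ /= ->//] : is_fderiv (fderivn j f) p (d j.+1 p).
  apply: (is_fderiv_ext Uo Up _ (dd j jk p Up)) => q Uq.
  by rewrite IH// ltnW.
split=> // j jk p Up; rewrite (E j.+1)//.
by apply: (is_fderiv_ext Uo Up _ (dd j jk p Up)) => q Uq; rewrite E// ltnW.
Qed.

(* [mlin V (bop V W) k] and [mlin V W k.+1] agree only up to the isometries
   [mlin_in] and [mlin_out]; the former is the type of the derivatives of a
   derivative. *)
Fixpoint mlin_in V W k : bop (mlin V (bop V W) k) (mlin V W k.+1) :=
  if k is k'.+1 then bop_post V (mlin_in V W k') else bop_id (bop V W).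

Fixpoint mlin_out V W k : bop (mlin V W k.+1) (mlin V (bop V W) k) :=
  if k is k'.+1 then bop_post V (mlin_out V W k') else bop_id (bop V W).

Lemma mlin_in_norm V W k : `|mlin_in V W k| <= 1.
Proof.
elim: k => [|k IH]; first exact: bop_id_norm.
by apply: le_trans IH; exact: bop_post_norm.
Qed.

Lemma mlin_out_norm V W k : `|mlin_out V W k| <= 1.
Proof.
elim: k => [|k IH]; first exact: bop_id_norm.
by apply: le_trans IH; exact: bop_post_norm.
Qed.

Lemma smooth_on_shift V W (U : set V) k (f : V -> W) (f' : V -> bop V W) :
  open U -> (forall p, U p -> is_fderiv f p (f' p)) -> smooth_on U k f' ->
  smooth_on U k.+1 f /\ forall j, (j <= k)%N -> forall p, U p ->
    fderivn j.+1 f p = mlin_in V W j (fderivn j f' p).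
Proof.
move=> Uo ff' f's.
pose d j : V -> mlin V W j :=
  match j with 0%N => f | j'.+1 => fun p => mlin_in V W j' (fderivn j' f' p) end.
have [] := @fderivn_tower V W U k.+1 f d Uo.
- by [].
- move=> [|j] jk p Up; first exact: ff'.
  exact: is_fderiv_linear (f's j _ _ _).
- by move=> fs fd; split=> // j jk p Up; exact: fd.
Qed.

Lemma smooth_on_fderiv V W (U : set V) k (f : V -> W) : open U ->
  smooth_on U k.+1 f -> smooth_on U k (fderiv f) /\
  forall j, (j <= k)%N -> forall p, U p ->
    fderivn j (fderiv f) p = mlin_out V W j (fderivn j.+1 f p).
Proof.
move=> Uo fs.
pose d j p := mlin_out V W j (fderivn j.+1 f p).
have [] := @fderivn_tower V _ U k (fderiv f) d Uo.
- by [].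
- by move=> j jk p Up; exact: is_fderiv_linear (fs j.+1 _ _ _).
- by move=> fs' fd; split.
Qed.

Lemma smooth_on_fderivn V W (U : set V) k b (f : V -> W) : open U ->
  smooth_on U (k + b) f -> smooth_on U k (fderivn b f).
Proof.
move=> Uo; elim: b k => [|b IH] k; first by rewrite addn0.
by rewrite addnS -addSn => /IH /(smooth_on_fderiv Uo)[].
Qed.

(** [equiC] restarts from the first derivative, with values in [bop V W], whereas [fderivn] keeps
    the codomain [W] and adds derivatives on the outside. [mlin_in] and [mlin_out] translate and,
    having norm at most 1, keep the Lipschitz constants. *)
Lemma equiC_smooth b I V W (U : set V) k (u : I -> V -> W) : open U ->
  equiC b U k u <-> (forall i, smooth_on U k (u i)) /\
    forall j, (j <= k)%N -> equi_lip b U (fun i => fderivn j (u i)).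
Proof.
move=> Uo; split.
  elim: k W u => [|k IH] W u.
    by move=> [ul _]; split=> // j; rewrite leqn0 => /eqP->.
  move=> /equiCS[ul [u' [uu' /IH[u's u'l]]]].
  have H i := smooth_on_shift Uo (uu' i) (u's i).
  split=> [i|[|j] jk]; [by have [] := H i|exact: ul|].
  move=> bT; have [K K0 KP] := u'l j jk bT; exists K => // i p q Up Uq.
  rewrite !(H i).2// -bop_subr (le_trans (bop_le _ _))//.
  by rewrite (le_trans (ler_pM _ _ (mlin_in_norm _ _ _) (KP _ _ _ Up Uq)))// mul1r.
elim: k W u => [|k IH] W u [us ul]; first by split=> //; exact: (ul 0%N).
apply/equiCS; split; first exact: (ul 0%N).
exists (fun i => fderiv (u i)); split.
  by move=> i p Up; exact: (us i 0%N).
have H i := smooth_on_fderiv Uo (us i).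
apply: IH; split=> [i|j jk]; first by have [] := H i.
move=> bT; have [K K0 KP] := ul j.+1 jk bT; exists K => // i p q Up Uq.
rewrite !(H i).2// -bop_subr (le_trans (bop_le _ _))//.
by rewrite (le_trans (ler_pM _ _ (mlin_out_norm _ _ _) (KP _ _ _ Up Uq)))// mul1r.
Qed.

(** A bound on the derivative of order [j.+1] makes the one of order [j] Lipschitz on a convex set;
    order [k.+1] only serves as a bound, whence the loss of one derivative. *)
Lemma equiC_of_bounds I V W (U : set V) k (u : I -> V -> W) (K : R) :
  open U -> segment_closed U -> 0 <= K -> (forall i, smooth_on U k.+1 (u i)) ->
  (forall i j p, (1 <= j <= k.+1)%N -> U p -> `|fderivn j (u i) p| <= K) ->
  equiC true U k u.
Proof.
move=> Uo Uc K0 us uK; apply/equiC_smooth => //; split.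
  by move=> i; exact: smooth_on_le (us i).
move=> j jk _; exists K => // i p q Up Uq.
apply: (mean_value_ineq Uc (fun v Uv => us i j _ v Uv)) => // v Uv.
exact: (uK i j.+1 v jk Uv).
Qed.

Lemma Ck_smooth_on V W (U : set V) k (f : V -> W) : Ck U k f -> smooth_on U k f.
Proof. by move=> [fd _]; apply/smooth_onP. Qed.

Lemma equiC_Ck I V W (U : set V) k (u : I -> V -> W) i : open U ->
  equiC true U k u -> Ck U k (u i).
Proof.
move=> Uo /equiC_smooth[]// us ul; split; first exact/smooth_onP.
move=> j jk p Up; have [K K0 KP] := ul j jk isT.
apply/cvgrPdist_le => e e0.
have [d d0 dU] := open_ball Uo Up.
apply/nbhs_normP; exists (Num.min d (e / (K + 1))).
  by rewrite /= lt_min d0 divr_gt0// ltr_wpDl.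
move=> q /=; rewrite lt_min distrC => /andP[/dU Uq qe].
rewrite distrC (le_trans (KP _ _ _ Up Uq))//.
rewrite (le_trans (ler_wpM2l K0 (ltW qe)))// mulrCA ger_pMr//.
by rewrite ler_pdivrMr ?ltr_wpDl// mul1r lerDl.
Qed.

(** The second difference of [f] at [p] is symmetric in [h] and [k], and the mean value inequality
    compares it with [f'' k h] up to an arbitrarily small multiple of [(|h| + |k|)^2]. Scaling both
    directions by a small [t] and dividing by [t^2] gives the equality. *)
Lemma second_fderiv_sym V W (U : set V) (f : V -> W) f' p f'' h k :
  open U -> U p -> (forall q, U q -> is_fderiv f q (f' q)) ->
  is_fderiv f' p f'' -> f'' h k = f'' k h.
Proof.
move=> Uo Up ff' f'f''.
have key (e : R) : 0 < e -> exists2 d, 0 < d & forall h k : V, `|h| < d -> `|k| < d ->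
    `|f (p + h + k) - f (p + h) - f (p + k) + f p - f'' k h| <=
      e * (`|h| + `|k|) ^+ 2.
  move=> e0; have e30 : 0 < e / 2 by rewrite divr_gt0.
  have [d1 d10 d1P] := f'f'' _ e30; have [d2 d20 d2P] := open_ball Uo Up.
  have d0 : 0 < Num.min d1 d2 / 2 by rewrite divr_gt0// lt_min d10.
  exists (Num.min d1 d2 / 2) => // {}h {}k hd kd.
  pose B := [set v | `|v - p| <= `|h|].
  have Bc : segment_closed B by exact: segment_closed_cball.
  have vk v : B v -> `|v + k - p| <= `|h| + `|k|.
    by move=> Bv; rewrite (_ : _ - _ = (v - p) + k); [exact: ler_normD2|zmod].
  have small r : r <= `|h| + `|k| -> r < Num.min d1 d2 by move: hd kd; lra.
  have Bd v : B v -> `|v - p| < Num.min d1 d2.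
    by move=> Bv; apply: small; rewrite (le_trans Bv)// lerDl.
  have Bkd v : B v -> `|v + k - p| < Num.min d1 d2.
    by move=> Bv; apply: small; exact: vk.
  have BU v : `|v - p| < Num.min d1 d2 -> U v by rewrite lt_min => /andP[_ /d2P].
  have Bp v : `|v - p| < Num.min d1 d2 -> `|v - p| < d1 by rewrite lt_min => /andP[].
  (* The increment of [g] from [p] to [p + h] is the second difference minus [f'' k h], and its
     derivative [g'] is a difference of two first-order remainders of [f'] at [p]. *)
  pose g v := f (v + k) - f v - f'' k v.
  have gE : f (p + h + k) - f (p + h) - f (p + k) + f p - f'' k h = g (p + h) - g p.
    by rewrite /g bop_addr; zmod.
  pose g' v := f' (v + k) - f' v - f'' k.
  rewrite gE (le_trans (@mean_value_ineq _ _ _ B g g' (e * (`|h| + `|k|)) Bc _ _ _ _ _ _)) //.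
  - move=> v Bv.
    have T1 : is_fderiv (fun v => f (v + k)) v (f' (v + k)).
      have Tk : is_fderiv (fun v => v + k) v (bop_id V).
        have := is_fderivD (is_fderiv_bop (bop_id V) v) (is_fderiv_cst k v).
        by rewrite addr0.
      have := is_fderiv_comp Tk (ff' _ (BU _ (Bkd _ Bv))).
      by congr (is_fderiv _ _ _); exact: bop_ext.
    exact: is_fderivB (is_fderivB T1 (ff' _ (BU _ (Bd _ Bv)))) (is_fderiv_bop _ _).
  - move=> v Bv.
    rewrite (_ : g' v = (f' (v + k) - f' p - f'' (v + k - p)) -
                        (f' v - f' p - f'' (v - p))); last first.
      by rewrite /g' !bop_subr bop_addr; zmod.
    rewrite [e]splitr mulrDl; apply: ler_normB2.
      by rewrite (le_trans (d1P _ (Bp _ (Bkd _ Bv))))// ler_pM2l//; exact: vk.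
    rewrite (le_trans (d1P _ (Bp _ (Bd _ Bv))))// ler_pM2l//.
    by rewrite (le_trans Bv)// lerDl.
  - by rewrite /B/= subrr normr0.
  - by rewrite /B/= addrC addKr.
  by rewrite (addrC p) addrK expr2 mulrA ler_wpM2l ?mulr_ge0 ?addr_ge0 ?(ltW e0)// lerDl.
apply/eqP; rewrite -subr_eq0 -normr_le0; apply/ler_addgt0Pr => e e0; rewrite add0r.
pose N := `|h| + `|k| + 1.
have N0 : 0 < N by rewrite ltr_wpDl// addr_ge0.
have [d d0 dP] := key (e / (2 * N ^+ 2)) (divr_gt0 e0 (mulr_gt0 (ltr0Sn _ _) (exprn_gt0 2 N0))).
have [t t0 tN] : exists2 t, 0 < t & t * N < d.
  exists (d / (2 * N)); first by rewrite divr_gt0// mulr_gt0.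
  by rewrite invfM mulrA divfK ?gt_eqF// ltr_pdivrMr// ltr_pMr// ltr1n.
have td (v : V) : `|v| <= N -> `|t *: v| < d.
  move=> vN; rewrite normrZ (gtr0_norm t0); apply: le_lt_trans tN.
  exact: ler_wpM2l (ltW t0) _ _ vN.
have hN : `|h| <= N by rewrite /N -addrA lerDl addr_ge0.
have kN : `|k| <= N by rewrite /N addrAC lerDr addr_ge0.
have H1 := dP _ _ (td _ hN) (td _ kN); have H2 := dP _ _ (td _ kN) (td _ hN).
have H3 := ler_normB2 H2 H1.
rewrite -(ler_pM2l (exprn_gt0 2 t0)).
have -> : t ^+ 2 * `|f'' h k - f'' k h| = `|f'' (t *: h) (t *: k) - f'' (t *: k) (t *: h)|.
  rewrite !(bop_scaler, bopZ) -!scalerBr !scalerA -expr2 normrZ.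
  by rewrite ger0_norm// exprn_ge0// ltW.
rewrite -normrN (_ : - (_ - f'' (t *: k) (t *: h)) =
  (f (p + t *: k + t *: h) - f (p + t *: k) - f (p + t *: h) + f p -
     f'' (t *: h) (t *: k)) -
  (f (p + t *: h + t *: k) - f (p + t *: h) - f (p + t *: k) + f p -
     f'' (t *: k) (t *: h))); last first.
  by rewrite (_ : p + t *: k + t *: h = p + t *: h + t *: k); zmod.
have sN : (`|t *: h| + `|t *: k|) ^+ 2 <= (t * N) ^+ 2.
  have tN0 : 0 <= t * N := mulr_ge0 (ltW t0) (ltW N0).
  rewrite ler_pXn2r// ?nnegrE ?addr_ge0//.
  by rewrite !normrZ (gtr0_norm t0) -mulrDr (ler_pM2l t0) /N lerDl.
rewrite (le_trans H3)// (addrC `|t *: k|) -mulrDl.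
have eN0 : 0 <= e / (2 * N ^+ 2) + e / (2 * N ^+ 2).
  by rewrite addr_ge0// divr_ge0 ?(ltW e0)// mulr_ge0// sqr_ge0.
rewrite (le_trans (ler_wpM2l eN0 sN))// exprMn.
by rewrite le_eqVlt; apply/orP; left; apply/eqP; field; rewrite gt_eqF.
Qed.

End HigherOrder.

(** * Derivatives along lists of directions *)

Section Evaluation.
Context {R : realType}.
Implicit Types V W Z : normedModType R.

Lemma bop_eval_subproof V W (h : V) : bounded_operator (fun f : bop V W => f h).
Proof. exact: bilin_left_bounded (@bop_eval_bilinear R V W). Qed.

Definition bop_eval V W (h : V) : bop (bop V W) W := mkbop (bop_eval_subproof W h).

Lemma bop_pre_subproof V1 V2 W (f : bop V1 V2) :
  bounded_operator (fun g : bop V2 W => bop_comp g f).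
Proof. exact: bilin_left_bounded (@bop_comp_bilinear R V1 V2 W). Qed.

Definition bop_pre V1 V2 W (f : bop V1 V2) : bop (bop V2 W) (bop V1 W) :=
  mkbop (bop_pre_subproof W f).

(* [hs] is meant to have size [k]; missing entries are read as [0]. *)
Fixpoint mlin_eval V W (k : nat) (hs : seq V) : bop (mlin V W k) W :=
  if k is k'.+1 then
    bop_comp (mlin_eval W k' (behead hs)) (bop_eval (mlin V W k') (head 0 hs))
  else bop_id W.

Lemma mlin_eval_le V W k hs (T : mlin V W k) : size hs = k ->
  `|mlin_eval W k hs T| <= `|T| * \prod_(h <- hs) `|h|.
Proof.
elim: k hs T => [|k IH] [|h hs] T //=.
  by rewrite big_nil mulr1.
move=> [shs]; rewrite big_cons mulrA (le_trans (IH hs (T h) shs))//.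
rewrite ler_wpM2r//; first by apply: prodr_ge0.
exact: bop_le.
Qed.

Lemma mlin_norm_le V W k (T : mlin V W k) (K : R) : 0 <= K ->
  (forall hs, size hs = k -> `|mlin_eval W k hs T| <= K * \prod_(h <- hs) `|h|) ->
  `|T| <= K.
Proof.
elim: k T K => [|k IH] T K K0 TK.
  by have := TK [::] erefl; rewrite big_nil mulr1.
apply: bop_norm_le => // h; apply: IH => [|hs shs]; first by rewrite mulr_ge0.
have := TK (h :: hs); rewrite big_cons mulrA; apply.
by rewrite /= shs.
Qed.

(* The head of [hs] is the outermost slot, i.e. the last differentiation. *)
Definition dirderiv V W (F : V -> W) (hs : seq V) (p : V) : W :=
  mlin_eval W (size hs) hs (fderivn (size hs) F p).

Section Dirderiv.
Context {V W : normedModType R} {U : set V} {k : nat} {F : V -> W}.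
Hypotheses (Uo : open U) (Fs : smooth_on U k F).

Lemma dirderiv_fderiv hs p : (size hs < k)%N -> U p -> exists2 L : bop V W,
  is_fderiv (dirderiv F hs) p L & forall h, L h = dirderiv F (h :: hs) p.
Proof.
move=> hk Up.
exists (bop_comp (mlin_eval W (size hs) hs) (fderivn (size hs).+1 F p)) => //.
exact: is_fderiv_linear (Fs hk Up).
Qed.

Lemma dirderiv_cons_eq hs hs' h p : size hs = size hs' -> (size hs < k)%N -> U p ->
  (forall q, U q -> dirderiv F hs q = dirderiv F hs' q) ->
  dirderiv F (h :: hs) p = dirderiv F (h :: hs') p.
Proof.
move=> shs hk Up E; have [L FL <-] := dirderiv_fderiv hk Up.
have [|L' FL' <-] := @dirderiv_fderiv hs' p _ Up; first by rewrite -shs.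
by rewrite (is_fderiv_unique (is_fderiv_ext Uo Up E FL) FL').
Qed.

Lemma dirderiv_swap2 h1 h2 hs p : ((size hs).+1 < k)%N -> U p ->
  dirderiv F (h1 :: h2 :: hs) p = dirderiv F (h2 :: h1 :: hs) p.
Proof.
move=> hk Up.
pose G' q := bop_comp (mlin_eval W (size hs) hs) (fderivn (size hs).+1 F q).
apply: (@second_fderiv_sym _ _ _ U (dirderiv F hs) G' p
  (bop_comp (bop_post V (mlin_eval W (size hs) hs)) (fderivn (size hs).+2 F p))) => //.
- by move=> q Uq; apply: is_fderiv_linear (Fs _ Uq); exact: ltnW.
- have := is_fderiv_linear (bop_post V (mlin_eval W (size hs) hs)) (Fs hk Up).
  by congr (is_fderiv _ _ _).
Qed.

(** Swaps of adjacent directions carry [h] across [s2]; the outer directions [s1] are added by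
    differentiating the identity for the shorter list. *)
Lemma dirderiv_move s1 h s2 s3 p :
  (size (s1 ++ h :: s2 ++ s3) <= k)%N -> U p ->
  dirderiv F (s1 ++ h :: s2 ++ s3) p = dirderiv F (s1 ++ s2 ++ h :: s3) p.
Proof.
elim: s1 p => [|a s1 IH] p /= sk Up; last first.
  apply: dirderiv_cons_eq => //; last by move=> q Uq; apply: IH => //; exact: ltnW.
  by rewrite !size_cat /= !size_cat /= !addnS.
elim: s2 p sk Up => [|a s2 IH] p //= sk Up.
rewrite dirderiv_swap2//; apply: dirderiv_cons_eq => //.
- by rewrite /= !size_cat /= addnS.
- by move=> q Uq; apply: IH => //; exact: ltnW.
Qed.

(** The outermost slot is additive because a derivative is linear; for an inner slot the identity is
    differentiated along the directions outside it. *)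
Lemma dirderivD s1 a b s2 p : (size (s1 ++ a :: s2) <= k)%N -> U p ->
  dirderiv F (s1 ++ (a + b) :: s2) p =
  dirderiv F (s1 ++ a :: s2) p + dirderiv F (s1 ++ b :: s2) p.
Proof.
elim: s1 p => [|h s1 IH] p /= sk Up.
  by have [L _ LE] := dirderiv_fderiv sk Up; rewrite -!LE bop_addr.
have sE c : size (s1 ++ c :: s2) = size (s1 ++ a :: s2) by rewrite !size_cat.
have [|L FL <-] := @dirderiv_fderiv (s1 ++ (a + b) :: s2) p _ Up; first by rewrite sE.
have [|La Fa <-] := @dirderiv_fderiv (s1 ++ a :: s2) p _ Up; first by rewrite sE.
have [|Lb Fb <-] := @dirderiv_fderiv (s1 ++ b :: s2) p _ Up; first by rewrite sE.
have E q : U q -> dirderiv F (s1 ++ a :: s2) q + dirderiv F (s1 ++ b :: s2) q =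
    dirderiv F (s1 ++ (a + b) :: s2) q.
  by move=> Uq; rewrite IH// ltnW.
by rewrite (is_fderiv_unique FL (is_fderiv_ext Uo Up E (is_fderivD Fa Fb))).
Qed.

End Dirderiv.

(** The pull-back of a multilinear map: [f] is composed into every slot and [M] is applied to the
    value. *)
Fixpoint mlin_pull V' V Y Z (f : bop V' V) (M : bop Y Z) (a : nat) :
    bop (mlin V Y a) (mlin V' Z a) :=
  if a is a'.+1 then bop_comp (bop_post V' (mlin_pull f M a')) (bop_pre (mlin V Y a') f)
  else M.

(** * Partial and full derivatives of maps on a product *)

Section Product.
Context {E X Y : normedModType R}.

Lemma pair_norm (p : E * X) : `|p| = Num.max `|p.1| `|p.2|.
Proof. by []. Qed.

Lemma inl_subproof : bounded_operator (fun e : E => (e, 0 : X)).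
Proof.
split=> [a u v|]; first by apply: injective_projections => //=; rewrite scaler0 addr0.
by exists 1 => e; rewrite mul1r pair_norm /= normr0 ge_max lexx normr_ge0.
Qed.

Lemma inr_subproof : bounded_operator (fun x : X => (0 : E, x)).
Proof.
split=> [a u v|]; first by apply: injective_projections => //=; rewrite scaler0 addr0.
by exists 1 => e; rewrite mul1r pair_norm /= normr0 ge_max lexx normr_ge0.
Qed.

Definition bop_inl : bop E (E * X)%type := mkbop inl_subproof.
Definition bop_inr : bop X (E * X)%type := mkbop inr_subproof.

Lemma bop_inl_norm : `|bop_inl| <= 1.
Proof.
by apply: bop_norm_le => // e; rewrite mul1r pair_norm /= normr0 ge_max lexx normr_ge0.
Qed.

Lemma bop_inr_norm : `|bop_inr| <= 1.
Proof.
by apply: bop_norm_le => // e; rewrite mul1r pair_norm /= normr0 ge_max lexx normr_ge0.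
Qed.

Context {S : set E} {k : nat} {F : E * X -> Y}.
Hypotheses (So : open S) (Fs : smooth_on (S `*` [set: X]) k F).

Lemma open_strip : open (S `*` [set: X]).
Proof.
rewrite openE => -[l x] [/= Sl _]; exists (S, setT) => //=; split.
  by rewrite nbhsE; exists S.
exact: filterT.
Qed.

Lemma is_fderiv_pairr l (x : X) : is_fderiv (fun v : X => (l, v)) x bop_inr.
Proof.
have := is_fderivD (is_fderiv_cst (bop_inl l) x) (is_fderiv_bop bop_inr x).
rewrite add0r; apply: (is_fderiv_ext openT) => // v _.
by apply: injective_projections; rewrite /= ?addr0 ?add0r.
Qed.

Lemma is_fderiv_pairl (l : E) (x : X) : is_fderiv (fun v : E => (v, x)) l bop_inl.
Proof.
have := is_fderivD (is_fderiv_bop bop_inl l) (is_fderiv_cst (bop_inr x) l).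
rewrite addr0; apply: (is_fderiv_ext openT) => // v _.
by apply: injective_projections; rewrite /= ?addr0 ?add0r.
Qed.

Lemma slice_smooth l : S l ->
  smooth_on [set: X] k (fun x => F (l, x)) /\
  forall b, (b <= k)%N -> forall x, fderivn b (fun x => F (l, x)) x =
    mlin_pull bop_inr (bop_id Y) b (fderivn b F (l, x)).
Proof.
move=> Sl; have [] := @fderivn_tower _ X Y setT k (fun x => F (l, x))
  (fun b x => mlin_pull bop_inr (bop_id Y) b (fderivn b F (l, x))) openT.
- by [].
- move=> j jk x _; have Sx : (S `*` setT) (l, x) by [].
  have /= := is_fderiv_comp (is_fderiv_pairr l x) (Fs jk Sx).
  move=> /(is_fderiv_linear (mlin_pull bop_inr (bop_id Y) j)).
  by congr (is_fderiv _ _ _); apply: bop_ext.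
- by move=> fs fd; split=> // b bk x; exact: fd.
Qed.

Lemma dirderiv_slice l vs x : S l -> (size vs <= k)%N ->
  dirderiv (fun v => F (l, v)) vs x = dirderiv F (map bop_inr vs) (l, x).
Proof.
move=> Sl; elim: vs x => [//|v vs IH] x sk.
have [gs _] := slice_smooth Sl.
have [L gL <-] := dirderiv_fderiv gs sk (I : setT x).
have sk' : (size (map bop_inr vs) < k)%N by rewrite size_map.
have [M FM] := dirderiv_fderiv Fs sk' (conj Sl I : (S `*` setT) (l, x)).
move=> <-; have /= FM' := is_fderiv_comp (is_fderiv_pairr l x) FM.
suff -> : L = bop_comp M bop_inr by [].
apply: (is_fderiv_unique gL); apply: (is_fderiv_ext openT I _ FM') => q _ /=.
by rewrite IH// ltnW.
Qed.

(** The base case is the slice at fixed [l]; each further direction in [es] differentiates the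
    identity for the shorter list through [bop_inl]. *)
Lemma dirderiv_pderivn l x es vs : S l -> (size es + size vs <= k)%N ->
  mlin_eval Y (size vs) vs (mlin_eval _ (size es) es
    (pderivn (size es) (size vs) (fun l' v' => F (l', v')) l x)) =
  dirderiv F (map bop_inl es ++ map bop_inr vs) (l, x).
Proof.
move=> + sk; set b := size vs in sk *.
pose H l' := fderivn b (fun v' => F (l', v')) x.
have bk : (b <= k)%N by apply: leq_trans sk; exact: leq_addl.
(* Before derivatives in [l] are taken, the partial derivative of order [b] in [x] must be known to
   be differentiable [k - b] times in [l]; the closure rules of [equiC false] give this. *)
have Hs : smooth_on S (k - b) H.
  have := @smooth_on_fderivn _ _ _ _ (k - b) b F open_strip.
  rewrite subnK// => /(_ Fs) FS.
  have HE : equiC false S (k - b) (fun _ : unit => H).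
    apply: (@equiC_ext _ _ _ _ _ _ _ (fun _ : unit => fun l' =>
      mlin_pull bop_inr (bop_id Y) b (fderivn b F (l', x)))) => //.
      by move=> _ l' Sl'; rewrite /H (slice_smooth Sl').2.
    apply: (@equiC_linear _ false _ _ _ _ _ _
      (fun=> mlin_pull bop_inr (bop_id Y) b)) => //.
    apply: (@equiC_comp _ false _ _ _ _ S (S `*` [set: X]) _
      (fun=> fderivn b F) (fun=> fun l' => (l', x))) => //.
    - exact: open_strip.
    - by apply/equiC_smooth => //; exact: open_strip.
    apply: (@equiC_ext _ _ _ _ _ _ _ (fun _ : unit => fun l' => bop_inl l' + bop_inr x)) => //.
      by move=> _ l' _; apply: injective_projections; rewrite /= ?addr0 ?add0r.
    apply: equiCD; last exact: (equiC_cst _ _ _ (fun=> bop_inr x)).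
    by apply: (equiC_bop _ _ (M := fun=> bop_inl)).
  have [] := (equiC_smooth _ _ _ _).1 HE => //.
  by move=> /(_ tt).
rewrite /pderivn -/H => Sl; elim: es l Sl sk => [|e es IH] l Sl sk.
  exact: dirderiv_slice.
have ek : (size es < k - b)%N by rewrite ltn_subRL addnC.
have HL := is_fderiv_linear (bop_comp (mlin_eval Y b vs) (mlin_eval _ (size es) es))
  (Hs _ ek _ Sl).
have sk' : (size (map bop_inl es ++ map bop_inr vs) < k)%N.
  by rewrite size_cat !size_map.
have [M FM ME] := dirderiv_fderiv Fs sk' (conj Sl I : (S `*` setT) (l, x)).
rewrite -ME.
have /= FM' := is_fderiv_comp (is_fderiv_pairl l x) FM.
suff LM : bop_comp (bop_comp (mlin_eval Y b vs) (mlin_eval _ (size es) es))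
    (fderivn (size es).+1 H l) = bop_comp M bop_inl.
  by rewrite -[RHS]/(bop_comp M bop_inl e) -LM.
apply: (is_fderiv_unique HL); apply: (is_fderiv_ext So Sl _ FM') => l' Sl' /=.
by rewrite -IH// ltnW.
Qed.

(* Splitting each direction into its two components leaves pure directions,
   which symmetry sorts into the order of [pderivn]. *)
Lemma dirderiv_bound (K : R) : 0 <= K -> forall p hs,
  (forall a b l v, (a + b = size hs)%N -> S l ->
    `|pderivn a b (fun l' v' => F (l', v')) l v| <= K) ->
  (size hs <= k)%N -> (S `*` [set: X]) p ->
  `|dirderiv F hs p| <= 2 ^+ size hs * K * \prod_(h <- hs) `|h|.
Proof.
move=> K0 [l x] hs pK hk Sp; have Sl : S l by case: Sp.
have split_bound gs es vs : (size gs + (size es + size vs) = size hs)%N ->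
    `|dirderiv F (gs ++ map bop_inl es ++ map bop_inr vs) (l, x)| <=
    2 ^+ size gs * K * (\prod_(h <- gs) `|h|) *
      ((\prod_(e <- es) `|e|) * \prod_(v <- vs) `|v|).
  (* The last entry of [gs] is split: its component in [E] joins [es], its component in [X] is moved
     past [es] to join [vs]. Each split doubles the bound, as both components have norm at most
     [|h|]. *)
  elim/last_ind: gs es vs => [|gs h IH] es vs.
    rewrite add0n => sE; rewrite big_nil mulr1 expr0 mul1r /=.
    rewrite -dirderiv_pderivn//; last by rewrite sE.
    rewrite (le_trans (mlin_eval_le _ _))// mulrA ler_wpM2r//.
      by apply: prodr_ge0.
    rewrite (le_trans (mlin_eval_le _ _))// ler_wpM2r//; first by apply: prodr_ge0.
    exact: pK.
  rewrite size_rcons => sE; rewrite cat_rcons.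
  have hE : h = bop_inl h.1 + bop_inr h.2.
    by apply: injective_projections; rewrite /= ?addr0 ?add0r.
  have szE (a : E * X) : (size (gs ++ a :: map bop_inl es ++ map bop_inr vs) <= k)%N.
    by rewrite size_cat /= size_cat !size_map addnS -addSn sE.
  rewrite {1}hE (dirderivD open_strip Fs)//.
  rewrite (dirderiv_move open_strip Fs (h := bop_inr h.2))//.
  have H1 := IH (h.1 :: es) vs; have H2 := IH es (h.2 :: vs).
  have {}H1 := H1 (etrans (addnS _ _) sE).
  have {}H2 : (size gs + (size es + size (h.2 :: vs)) = size hs)%N -> _ := H2.
  have {}H2 := H2 (etrans (congr1 (addn _) (addnS _ _)) (etrans (addnS _ _) sE)).
  rewrite (le_trans (ler_normD2 H1 H2))//.
  rewrite !big_cons -cats1 big_cat big_seq1 exprSr /=.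
  set A := 2 ^+ size gs; set G := \prod_(i <- gs) _.
  set Pe := \prod_(i <- es) _; set Pv := \prod_(i <- vs) _.
  have T : 0 <= A * K * G * Pe * Pv.
    by rewrite !mulr_ge0 ?exprn_ge0//; apply: prodr_ge0.
  rewrite [leLHS](_ : _ = (`|h.1| + `|h.2|) * (A * K * G * Pe * Pv)); last by ring.
  rewrite [leRHS](_ : _ = (`|h| + `|h|) * (A * K * G * Pe * Pv)); last by ring.
  by rewrite ler_wpM2r// lerD// (pair_norm h) le_max lexx ?orbT.
have := split_bound hs [::] [::]; rewrite !big_nil !mulr1 !cats0; apply.
by rewrite addn0.
Qed.

End Product.
End Evaluation.

(** * Green sums and bounded solutions *)

Section Solvability.
Context {R : realType}.
Implicit Types Z : normedModType R.

(** Unique bounded solvability of [v (n + 1) = T n (v n) + w n] in weighted form. Uniqueness is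
    recorded for the homogeneous equation; it extends the bound on the solution provided to every
    bounded solution. *)
Definition solvable_eq Z (om : int -> R) (K : R) (T : int -> bop Z Z) :=
  (forall (w : int -> Z) (N : R), (forall n, `|w n| <= N * om n) ->
    exists v : int -> Z, (forall n, `|v n| <= K * N) /\
      forall n, v (n + 1) = T n (v n) + w n) /\
  (forall v : int -> Z, (exists M : R, forall n, `|v n| <= M) ->
    (forall n, v (n + 1) = T n (v n)) -> forall n, v n = 0).

Lemma solvable_eq_bound Z om K (T : int -> bop Z Z) w v N :
  solvable_eq om K T -> (exists M : R, forall n, `|v n| <= M) ->
  (forall n, `|w n| <= N * om n) -> (forall n, v (n + 1) = T n (v n) + w n) ->
  forall n, `|v n| <= K * N.
Proof.
move=> [ex uniq] [M vM] wN vE n; have [v' [v'N v'E]] := ex w N wN.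
suff vv' : v n - v' n = 0 by rewrite -[v n](subrK (v' n)) vv' add0r.
move: n; apply: (uniq (fun n => v n - v' n)).
  by exists (M + K * N) => n; exact: ler_normB2.
by move=> n; rewrite vE v'E bop_subr; zmod.
Qed.

(** The equation is solved at each vector [h] separately; uniqueness makes the solutions linear in
    [h] and the estimate makes them bounded operators. Equations for derivatives in the parameter
    thus inherit solvability with the same [K]. *)
Lemma solvable_eq_post Z (E : normedModType R) om K (T : int -> bop Z Z) :
  (forall n, 0 < om n) -> 0 <= K -> solvable_eq om K T ->
  solvable_eq om K (fun n => bop_post E (T n)).
Proof.
move=> om0 K0 sT; have [ex uniq] := sT; split=> [w N wN|v [M vM] vE n]; last first.
  apply: bop_ext => h; move: n; apply: (uniq (fun n => v n h)).
    by exists (M * `|h|) => n; rewrite (le_trans (bop_le _ _))// ler_wpM2r.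
  by move=> n; rewrite vE.
have whN h n : `|w n h| <= (N * `|h|) * om n.
  by rewrite (le_trans (bop_le _ _))// mulrAC ler_wpM2r.
pose v h := projT1 (cid (ex _ _ (whN h))).
have vN h n : `|v h n| <= K * (N * `|h|) by rewrite /v; case: cid => ? [].
have vE h n : v h (n + 1) = T n (v h n) + w n h.
  by rewrite /v; case: cid => u [uN uE] /=; exact: uE.
have v_bop n : bounded_operator (v^~ n).
  split=> [a x y|]; last by exists (K * N) => h; rewrite -mulrA.
  suff : v (a *: x + y) n - (a *: v x n + v y n) = 0 by move/subr0_eq.
  move: n; apply: (uniq (fun n => v (a *: x + y) n - (a *: v x n + v y n))).
    exists (K * (N * `|a *: x + y|) + (`|a| * (K * (N * `|x|)) + K * (N * `|y|))) => n.
    by apply: ler_normB2 => //; apply: ler_normD2 => //; rewrite normrZ ler_wpM2l.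
  move=> n; rewrite !vE !bop_subr !bop_addr !bop_scaler !scalerDr; zmod.
have N0 : 0 <= K * N.
  by rewrite mulr_ge0// -(pmulr_lge0 _ (om0 0)) (le_trans _ (wN 0)).
exists (fun n => mkbop (v_bop n)); split=> n; last by apply: bop_ext => h /=; exact: vE.
apply: bop_norm_le => // h; rewrite -mulrA; exact: vN.
Qed.

End Solvability.

(** * The Green operator as a series over the integers *)

Section Green.
Context {R : realType} {X : completeNormedModType R}.
Variables (A Ainv : int -> bop X X) (P : int -> bop X X).
Hypothesis AVK : forall n, cancel (Ainv n) (A n).

Let G m n := green A Ainv P m n.

Lemma cocycleS m n v : cocycle A Ainv (m + 1) n v = A m (cocycle A Ainv m n v).
Proof.
rewrite /cocycle; have [nm|mn] := leP n m.
  have -> : n <= m + 1 by lia.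
  have -> : absz (m + 1 - n)%R = (absz (m - n)%R).+1 by lia.
  by rewrite /=; congr (A _ _); lia.
have -> : absz (n - m)%R = (absz (n - (m + 1))%R).+1 by lia.
(* The outermost factor of the backward product is [Ainv m], which [A m] cancels. *)
have E : (n - (absz (n - (m + 1))%R).+1%:Z) = m by lia.
rewrite [cocycle_bwd _ _ _.+1]/= E /= AVK; case: ifPn => // nm1.
have -> : absz (m + 1 - n)%R = 0%N by lia.
by have -> : absz (n - (m + 1))%R = 0%N by lia.
Qed.

(** In [m] the kernel solves the homogeneous equation except for a jump by the identity at
    [n = m + 1], where [-(Id - P n)] gives way to [P n]. *)
Lemma greenS m n v :
  G (m + 1) n v = A m (G m n v) + (if n == m + 1 then v else 0).
Proof.
rewrite /G /green; have [nm|mn] := leP n m.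
  have -> : n <= m + 1 by lia.
  have -> : (n == m + 1) = false by lia.
  by rewrite addr0 /= cocycleS.
have [nE|nm1] := eqVneq n (m + 1).
  subst n; rewrite lexx bopN bop_oppr.
  have cid w : cocycle A Ainv (m + 1) (m + 1) w = w by rewrite /cocycle lexx subrr.
  have := cocycleS m (m + 1) (v - P (m + 1) v); rewrite cid.
  rewrite -[A m (bop_comp _ _ v)]/(A m (cocycle A Ainv m (m + 1) (v - P (m + 1) v))) => <-.
  rewrite -[LHS]/(cocycle A Ainv (m + 1) (m + 1) (P (m + 1) v)) cid; zmod.
have -> : (n <= m + 1) = false by lia.
by rewrite addr0 !bopN bop_oppr -[A m (bop_comp _ _ v)]cocycleS.
Qed.

(** The enumeration 0, -1, 1, -2, ... turns sums over the integers into series over the naturals. *)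
Definition int_enum (j : nat) : int := if odd j then Negz j./2 else Posz j./2.

Lemma int_enum_inj : injective int_enum.
Proof.
move=> i j; rewrite /int_enum.
by case: ifPn; case: ifPn => oj oi // [] E; lia.
Qed.

Lemma int_enum_surj n : exists j, int_enum j = n.
Proof.
case: n => n; [exists n.*2|exists n.*2.+1]; rewrite /int_enum /= odd_double /=.
  by rewrite doubleK.
by rewrite uphalf_double.
Qed.

(** The forcing [r (n - 1)] first enters the solution at time [n], hence the shift, which the
    weights in [green_sum] share. *)
Definition green_series (r : int -> X) (m : int) : nat -> X :=
  series (fun j => G m (int_enum j) (r (int_enum j - 1))).

Definition green_op (r : int -> X) (m : int) : X := limn (green_series r m).

Definition green_dominated (r : int -> X) (T : R) := forall m N,
  \sum_(0 <= j < N) `|G m (int_enum j)| * `|r (int_enum j - 1)| <= T.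

Lemma green_series_le r T m N : green_dominated r T ->
  [normed series (fun j => G m (int_enum j) (r (int_enum j - 1)))] N <= T.
Proof.
move=> rT; rewrite (le_trans _ (rT m N))//= ler_sum// => j _.
exact: bop_le.
Qed.

Lemma green_cvg r T m : green_dominated r T ->
  green_series r m @ \oo --> green_op r m.
Proof.
move=> rT; apply: normed_cvg; apply: nondecreasing_is_cvgn.
  by apply: nondecreasing_series => j _ _; exact: normr_ge0.
by exists T => _ [N _ <-]; exact: green_series_le.
Qed.

Lemma cvg_norm_le (u : nat -> X) l (T : R) : u @ \oo --> l ->
  (forall n, `|u n| <= T) -> `|l| <= T.
Proof.
move=> ul uT; have := @cvgr_to_le _ _ _ _ _ `|l| T (cvg_norm ul); apply.
exact: nearW.
Qed.

Lemma green_op_le r T m : green_dominated r T -> `|green_op r m| <= T.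
Proof.
move=> rT; apply: (cvg_norm_le (green_cvg (m := m) rT)) => N.
rewrite (le_trans _ (green_series_le m N rT))//.
exact: ler_norm_sum.
Qed.

(** The jump relation [greenS] is summed term by term; once the partial sum has passed the index
    enumerating [m + 1], the jumps contribute exactly [r m]. *)
Lemma green_op_eqn r T m : green_dominated r T ->
  green_op r (m + 1) = A m (green_op r m) + r m.
Proof.
move=> rT; have [j0 j0E] := int_enum_surj (m + 1).
apply: (norm_cvg_unique (green_cvg (m := m + 1) rT)).
have : (A m (green_series r m n) + r m) @[n --> \oo] --> A m (green_op r m) + r m.
  apply: cvgD; last exact: cvg_cst.
  apply: (@continuous_cvg _ _ _ _ _ _ (A m)); first exact: bop_continuous.
  exact: (green_cvg (m := m) rT).
apply: cvg_trans; apply: near_eq_cvg; exists j0.+1 => // N /= jN.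
rewrite /green_series /series /= raddf_sum /=.
under [RHS]eq_bigr do rewrite greenS.
rewrite big_split /=; congr (_ + _).
rewrite big_mkord (bigD1 (Ordinal jN))//= j0E eqxx addrK big1 ?addr0// => j jj0.
case: eqP => // jE; case/eqP: jj0; apply/val_inj/int_enum_inj => /=.
by rewrite jE j0E.
Qed.

End Green.

(** * A priori estimates and solvability of perturbed equations *)

Section GreenSum.
Context {R : realType} {X : completeNormedModType R}.
Variables (A Ainv : int -> bop X X) (P : int -> bop X X).
Variables (c eps : int -> R).
Hypothesis AVK : forall n, cancel (Ainv n) (A n).
Hypothesis c_ge0 : forall n, 0 <= c n.
Hypothesis eps_gt0 : forall n, 0 < eps n.
Hypothesis no_bounded : forall u : int -> X,
  (forall n, u (n + 1) = A n (u n)) ->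
  (exists M : R, forall n, `|u n| <= M) -> forall n, u n = 0.
Hypothesis q_lt1 : (green_sum A Ainv P c < 1)%E.
Hypothesis L_fin : (green_sum A Ainv P eps < +oo)%E.

Lemma green_sum_ge (w : int -> R) m N :
  ((\sum_(0 <= j < N) `|green A Ainv P m (int_enum j)| * w (int_enum j - 1))%:E
    <= green_sum A Ainv P w)%E.
Proof.
apply: (@le_trans _ _ (\esum_(n in [set: int]) (w (n - 1) * `|green A Ainv P m n|)%:E)%E);
  last by apply: ereal_sup_ubound; exists m.
apply: esum_ge; exists [set` map int_enum (iota 0 N)]; first by split=> //; exact: finite_seq.
rewrite -fsbig_seq; last by rewrite map_inj_uniq ?iota_uniq//; exact: int_enum_inj.
rewrite big_map sumEFin lee_fin /index_iota subn0 le_eqVlt; apply/orP; left; apply/eqP.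
by apply: eq_bigr => j _; rewrite mulrC.
Qed.

Lemma green_sum_fin_num (w : int -> R) :
  (green_sum A Ainv P w < +oo)%E -> green_sum A Ainv P w \is a fin_num.
Proof.
move=> wfin; rewrite ge0_fin_numE//.
by have := green_sum_ge w 0 0; rewrite big_geq.
Qed.

Lemma fine_green_sum_ge0 (w : int -> R) : 0 <= fine (green_sum A Ainv P w).
Proof. by apply: fine_ge0; have := green_sum_ge w 0 0; rewrite big_geq. Qed.

Lemma green_sum_dominates (w : int -> R) m N :
  (green_sum A Ainv P w < +oo)%E ->
  \sum_(0 <= j < N) `|green A Ainv P m (int_enum j)| * w (int_enum j - 1) <=
  fine (green_sum A Ainv P w).
Proof. by move=> wfin; rewrite -lee_fin fineK ?green_sum_fin_num// green_sum_ge. Qed.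

Let q := fine (green_sum A Ainv P c).
Let L := fine (green_sum A Ainv P eps).

Let c_fin : (green_sum A Ainv P c < +oo)%E.
Proof. exact: lt_trans q_lt1 (ltry 1). Qed.

Lemma green_q_lt1 : q < 1.
Proof. by rewrite -lte_fin fineK ?green_sum_fin_num. Qed.

Lemma green_dominated_le (r : int -> X) M N : 0 <= M -> 0 <= N ->
  (forall n, `|r n| <= M * c n + N * eps n) ->
  green_dominated A Ainv P r (M * q + N * L).
Proof.
move=> M0 N0 rMN m n.
have H1 := green_sum_dominates m n c_fin.
have H2 := green_sum_dominates m n L_fin.
rewrite (le_trans _ (lerD (ler_wpM2l M0 H1) (ler_wpM2l N0 H2)))//.
rewrite !mulr_sumr -big_split /= ler_sum// => j _.
rewrite (le_trans (ler_wpM2l (normr_ge0 _) (rMN _)))//.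
by rewrite mulrDr le_eqVlt; apply/orP; left; apply/eqP; ring.
Qed.

(* A bounded sequence is the Green sum of its own forcing. *)
Lemma forced_bound (v : int -> X) M N : 0 <= M -> 0 <= N ->
  (exists M', forall n, `|v n| <= M') ->
  (forall n, `|v (n + 1) - A n (v n)| <= M * c n + N * eps n) ->
  forall n, `|v n| <= M * q + N * L.
Proof.
move=> M0 N0 [M' vM'] vMN n.
pose r (n : int) := v (n + 1) - A n (v n).
have rd : green_dominated A Ainv P r (M * q + N * L) by exact: green_dominated_le.
suff -> : v n = green_op A Ainv P r n by exact: green_op_le.
apply/eqP; rewrite -subr_eq0; apply/eqP; move: n.
apply: (no_bounded (u := fun n => v n - green_op A Ainv P r n)).
  by move=> n; rewrite (green_op_eqn AVK n rd) -[r n]/(v (n + 1) - A n (v n)) bop_subr; zmod.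
by exists (M' + (M * q + N * L)) => n; apply: ler_normB2 => //; exact: green_op_le.
Qed.

(** The supremum [s] of [|v n|] satisfies [s <= (s + N) q + N L], and [q < 1] lets [s] be absorbed
    on the left. *)
Lemma apriori_bound (v : int -> X) N : 0 <= N -> (exists M', forall n, `|v n| <= M') ->
  (forall n, `|v (n + 1) - A n (v n)| <= c n * `|v n| + N * (eps n + c n)) ->
  forall n, `|v n| <= (q + L) / (1 - q) * N.
Proof.
move=> N0 [M' vM'] vN.
pose B := [set `|v n| | n in [set: int]].
have Bs : has_sup B by split; [exists `|v 0|, 0|exists M' => _ [n _ <-]].
have vs n : `|v n| <= sup B by apply: (sup_upper_bound Bs); exists n.
have s0 : 0 <= sup B by rewrite (le_trans _ (vs 0)).
have vb n : `|v n| <= (sup B + N) * q + N * L.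
  move: n; apply: forced_bound => //; [by rewrite addr_ge0|by exists M'|] => n.
  rewrite (le_trans (vN n))// (le_trans (lerD (ler_wpM2l (c_ge0 n) (vs n)) (lexx _)))//.
  by rewrite le_eqVlt; apply/orP; left; apply/eqP; ring.
have sb : sup B <= (sup B + N) * q + N * L.
  by apply: ge_sup; [exists `|v 0|, 0|move=> _ [n _ <-]].
move=> n; rewrite (le_trans (vs n))// mulrAC ler_pdivlMr ?subr_gt0 ?green_q_lt1//.
by move: sb; lra.
Qed.

(** Existence by iterating the Green operator on the forcing [B n (v n) + w n], a contraction with
    factor [q] in the supremum norm; uniqueness is the a priori bound with [N = 0]. *)
Lemma solvable_eq_perturbed (B : int -> bop X X) : (forall n, `|B n| <= c n) ->
  solvable_eq (fun n => eps n + c n) ((q + L) / (1 - q)) (fun n => A n + B n).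
Proof.
move=> Bc; split=> [w N wN|v vb vE n]; last first.
  have := apriori_bound (lexx 0) vb; rewrite mulr0 => H.
  apply/eqP; rewrite -normr_le0; move: n; apply: H => n.
  by rewrite vE bopD addrC addKr mul0r addr0 (le_trans (bop_le _ _))// ler_wpM2r.
have N0 : 0 <= N.
  rewrite -(pmulr_lge0 _ (_ : 0 < eps 0 + c 0)) ?(le_trans _ (wN 0))//.
  by rewrite ltr_wpDr.
pose K := (q + L) / (1 - q).
have q1 : 0 < 1 - q by rewrite subr_gt0 green_q_lt1.
have K0 : 0 <= K by rewrite divr_ge0 ?(ltW q1)// addr_ge0 ?fine_green_sum_ge0.
pose step (v : int -> X) := green_op A Ainv P (fun n => B n (v n) + w n).
pose u i := iter i step (fun=> 0).
(* [K * N] is the fixed point of the bound sending [s] to [(s + N) q + N L], so the iterates stay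
   below it. *)
have KE : (K * N + N) * q + N * L = K * N.
  by rewrite /K; field; rewrite gt_eqF.
have dom (v : int -> X) : (forall n, `|v n| <= K * N) ->
    green_dominated A Ainv P (fun n => B n (v n) + w n) ((K * N + N) * q + N * L).
  move=> vK; apply: green_dominated_le => //; first by rewrite addr_ge0// mulr_ge0.
  move=> n; rewrite (le_trans (ler_normD2 (bop_le _ _) (wN n)))//.
  rewrite (le_trans (lerD (ler_pM _ _ (Bc n) (vK n)) (lexx _)))//.
  by rewrite le_eqVlt; apply/orP; left; apply/eqP; ring.
have ub i n : `|u i n| <= K * N.
  elim: i n => [|i IH] n; first by rewrite normr0 mulr_ge0.
  by rewrite -KE; apply: green_op_le; exact: dom.
have uE i n : u i.+1 (n + 1) = A n (u i.+1 n) + (B n (u i n) + w n).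
  by have := green_op_eqn AVK n (dom _ (ub i)).
have qKi i : 0 <= q ^+ i * (K * N).
  by apply: mulr_ge0; [exact/exprn_ge0/fine_green_sum_ge0|exact: mulr_ge0].
have du i n : `|u i.+1 n - u i n| <= q ^+ i * (K * N).
  elim: i n => [|i IH] n; first by rewrite subr0 expr0 mul1r.
  have qK := qKi i.
  have := @forced_bound (fun n => u i.+2 n - u i.+1 n) (q ^+ i * (K * N)) 0 qK (lexx 0).
  rewrite mul0r addr0 (_ : _ * q = q ^+ i.+1 * (K * N)); last by rewrite exprSr; ring.
  apply.
    by exists (K * N + K * N) => m; exact: ler_normB2.
  move=> m; rewrite !uE bop_subr mul0r addr0.
  rewrite (_ : _ - _ = B m (u i.+1 m - u i m)); last by rewrite bop_subr; zmod.
  by rewrite (le_trans (bop_le _ _))// mulrC ler_pM.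
have ucvg n : cvgn (fun i => u i n).
  (* The increments are dominated by a geometric series of ratio [q], and their series telescopes to
     the iterates. *)
  have : cvgn (series (fun i => u i.+1 n - u i n)).
    apply: normed_cvg; apply: (@series_le_cvg _ _ (geometric (K * N) q)) => //.
    - by move=> i; exact: normr_ge0.
    - by move=> i; rewrite /geometric /= mulrC.
    - by move=> i; rewrite /geometric /= mulrC; exact: du.
    - by apply: is_cvg_geometric_series; rewrite ger0_norm ?fine_green_sum_ge0 ?green_q_lt1.
  have := telescopeK (fun i => u i n); rewrite /telescope => -> /=.
  by under eq_fun do rewrite subr0.
pose v n := limn (fun i => u i n).
have uv n : (fun i => u i n) @ \oo --> v n by exact: ucvg.
exists v; split=> n; first by apply: (cvg_norm_le (uv n)).
have us m : (fun i => u i.+1 m) @ \oo --> v m by rewrite (cvg_shiftS (fun i => u i m)).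
apply: (norm_cvg_unique (us (n + 1))).
have : A n (u i.+1 n) + (B n (u i n) + w n) @[i --> \oo] --> (A n + B n) (v n) + w n.
  rewrite bopD -addrA; apply: cvgD.
    by apply: (@continuous_cvg _ _ _ _ _ _ (A n)); [exact: bop_continuous|exact: us].
  apply: cvgD; last exact: cvg_cst.
  by apply: (@continuous_cvg _ _ _ _ _ _ (B n)); [exact: bop_continuous|exact: uv].
by apply: cvg_trans; apply: near_eq_cvg; apply: nearW => i; rewrite uE.
Qed.

End GreenSum.

(** * Linear equations with a parameter *)

Section LinearEquation.
Context {R : realType}.
Implicit Types V W Z : normedModType R.

Lemma is_fderiv_quadratic V W (U : set V) (f : V -> W) p (L : bop V W) (C : R) :
  open U -> U p -> 0 <= C ->
  (forall q, U q -> `|f q - f p - L (q - p)| <= C * `|q - p| ^+ 2) ->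
  is_fderiv f p L.
Proof.
move=> Uo Up C0 fC e e0; have [d d0 dU] := open_ball Uo Up.
have C1 : 0 < C + 1 by rewrite ltr_wpDl.
exists (Num.min d (e / (C + 1))); first by rewrite lt_min d0 divr_gt0.
move=> q; rewrite lt_min => /andP[/dU Uq]; rewrite ltr_pdivlMr// => qe.
rewrite (le_trans (fC q Uq))// expr2 mulrA ler_wpM2r//.
by rewrite (le_trans _ (ltW qe))// mulrC ler_wpM2l// lerDl.
Qed.

Lemma scaled_norm_le V (a M : R) (v : V) : 0 < a -> `|a^-1 *: v| <= M -> `|v| <= M * a.
Proof.
by move=> a0; rewrite normrZ gtr0_norm ?invr_gt0// mulrC ler_pdivrMr.
Qed.

Lemma norm_scaled_le V (a M : R) (v : V) : 0 < a -> `|v| <= M * a -> `|a^-1 *: v| <= M.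
Proof.
by move=> a0; rewrite normrZ gtr0_norm ?invr_gt0// ler_pdivrMl// mulrC.
Qed.

Lemma bop_post_bounded V W Z :
  bounded_operator (fun g : bop W Z => bop_post V g).
Proof.
split=> [a f g|]; first by apply: bop_ext => u; apply: bop_ext.
by exists 1 => g; rewrite mul1r bop_post_norm.
Qed.

Lemma bop_eval_comp_bilinear V W Z :
  bilinear_bounded (fun (g : bop V (bop W Z)) (w : W) => bop_comp (bop_eval Z w) g) 1.
Proof.
split=> //.
- by move=> g a x y; apply: bop_ext => v /=; rewrite bop_addr bop_scaler.
- by move=> w a f g; apply: bop_ext.
- move=> g w; apply: bop_norm_le => [|v]; first by rewrite !mulr_ge0.
  rewrite mul1r /= (le_trans (bop_le _ _))// mulrAC ler_wpM2r// bop_le//.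
Qed.

Context {E : normedModType R} {U : set E} {om : int -> R} {K : R}.
Hypotheses (Uo : open U) (Uc : segment_closed U) (om0 : forall n, 0 < om n) (K0 : 0 <= K).

(** The increment of [v] from [l] to [m] solves the equation at [m], forced by the increments of [T]
    and [w]. Dividing [T] and [w] by [om] expresses that these increments are of the order of the
    weight, as solvability requires. *)
Lemma solution_equi_lip Z (T : int -> E -> bop Z Z) (w v : int -> E -> Z) :
  (forall l, U l -> solvable_eq om K (T^~ l)) ->
  equi_lip true U (fun n l => (om n)^-1 *: T n l) ->
  equi_lip true U (fun n l => (om n)^-1 *: w n l) ->
  equi_bdd true U v ->
  (forall n l, U l -> v (n + 1) l = T n l (v n l) + w n l) ->
  equi_lip true U v.
Proof.
move=> sT Tl wl vb vE _.
have [KT KT0 KTP] := Tl isT; have [Kw Kw0 KwP] := wl isT; have [M M0 MP] := vb isT.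
exists (K * (KT * M + Kw)); first by rewrite mulr_ge0// addr_ge0// mulr_ge0.
move=> n l m Ul Um; rewrite -mulrA; move: n.
apply: (solvable_eq_bound (v := fun n => v n m - v n l)
  (w := fun n => (T n m - T n l) (v n l) + (w n m - w n l)) (sT m Um)).
- by exists (M + M) => n; apply: ler_normB2; exact: MP.
- move=> n; rewrite mulrDl mulrDl; apply: ler_normD2.
    rewrite (le_trans (bop_le _ _))//.
    rewrite [leRHS](_ : _ = (KT * `|m - l| * om n) * M); last by ring.
    apply: ler_pM => //; last exact: MP.
    by apply: scaled_norm_le => //; rewrite scalerBr; exact: KTP.
  by apply: scaled_norm_le => //; rewrite scalerBr; exact: KwP.
- by move=> n; rewrite !vE// bopB bop_subr; zmod.
Qed.

Lemma equiC_post j Z (T : int -> E -> bop Z Z) :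
  equiC true U j (fun n l => (om n)^-1 *: T n l) ->
  equiC true U j (fun n l => (om n)^-1 *: bop_post E (T n l)).
Proof.
move=> TC.
have H := equiC_linear (b := true)
  (M := fun _ : int => mkbop (bop_post_bounded E Z Z)) _ TC.
apply: (equiC_ext Uo _ (H _)) => [n l Ul|_].
  by apply: bop_ext => g; exact: bop_ext.
by exists 1 => // _; apply: bop_norm_le => // g; rewrite mul1r; exact: bop_post_norm.
Qed.

(** Induction on [j]: the candidate derivative is the bounded solution of the differentiated
    equation, posed in [bop E Z]. Its forcing is built from [T'], [w'] and [v], the last being
    covered by the induction hypothesis, which then applies to the candidate too. *)
Lemma solution_equiC j Z (T : int -> E -> bop Z Z) (w v : int -> E -> Z) :
  (forall l, U l -> solvable_eq om K (T^~ l)) ->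
  equiC true U j (fun n l => (om n)^-1 *: T n l) ->
  equiC true U j (fun n l => (om n)^-1 *: w n l) ->
  equi_bdd true U v ->
  (forall n l, U l -> v (n + 1) l = T n l (v n l) + w n l) ->
  equiC true U j v.
Proof.
elim: j Z T w v => [|j IH] Z T w v sT TC wC vb vE.
  by split=> //; exact: solution_equi_lip sT (equiC_lip TC) (equiC_lip wC) vb vE.
have vl := solution_equi_lip sT (equiC_lip TC) (equiC_lip wC) vb vE.
have vC := IH _ _ _ _ sT (equiC_weak TC) (equiC_weak wC) vb vE.
have /equiCS[Tl [T' [TT' T'C]]] := TC; have /equiCS[wl [w' [ww' w'C]]] := wC.
have T'b := equi_lip_deriv_bdd Uo Tl TT'; have w'b := equi_lip_deriv_bdd Uo wl ww'.
(* [G] is the forcing of the differentiated equation divided by the weight, since [T'] and [w']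
   differentiate the rescaled families. *)
pose G n l := bop_comp (bop_eval Z (v n l)) (T' n l) + w' n l.
have GC : equiC true U j G.
  apply: equiCD => //.
  exact: (equiC_bilin Uo (bop_eval_comp_bilinear E Z Z) T'C vC T'b vb).
have [KT KT0 KTP] := Tl isT; have [M M0 MP] := vb isT; have [Kv Kv0 KvP] := vl isT.
have [N [N0 NP]] : exists N, 0 <= N /\ forall n l, U l -> `|om n *: G n l| <= N * om n.
  have [N1 N10 N1P] := T'b isT; have [N2 N20 N2P] := w'b isT.
  exists (N1 * M + N2); split=> [|n l Ul]; first by rewrite addr_ge0// mulr_ge0.
  apply: scaled_norm_le => //; rewrite scalerA mulVf ?gt_eqF// scale1r.
  apply: ler_normD2; last exact: N2P.
  apply: bop_norm_le => [|h]; first by rewrite mulr_ge0.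
  rewrite /= (le_trans (bop_le _ _))// [leRHS]mulrAC ler_pM//; last exact: MP.
  by rewrite (le_trans (bop_le _ _))// ler_wpM2r// N1P.
have sT' l : U l -> solvable_eq om K (fun n => bop_post E (T n l)).
  by move=> Ul; apply: solvable_eq_post => //; exact: sT.
have v'ex l : exists v' : int -> bop E Z, U l -> (forall n, `|v' n| <= K * N) /\
    forall n, v' (n + 1) = bop_post E (T n l) (v' n) + om n *: G n l.
  have [Ul|nUl] := pselect (U l); last by exists (fun=> 0).
  by have [v' v'P] := (sT' l Ul).1 _ N (fun n => NP n l Ul); exists v'.
have [v' v'P] := choice v'ex.
apply/equiCS; split=> //; exists (fun n l => v' l n); split; last first.
  apply: (IH _ (fun n l => bop_post E (T n l)) (fun n l => om n *: G n l)) => //.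
  - exact: equiC_post (equiC_weak TC).
  - apply: equiC_ext GC => // n l Ul.
    by rewrite scalerA mulVf ?gt_eqF// scale1r.
  - by move=> _; exists (K * N); [rewrite mulr_ge0|move=> n l /v'P[]].
  - by move=> n l /v'P[].
move=> n l Ul; have [v'b v'E] := v'P l Ul.
have [KT' KT'0 KT'P] := equiC_lip T'C isT; have [Kw' Kw'0 Kw'P] := equiC_lip w'C isT.
(* The three summands bound the remainder of [T], the product of the increments of [T] and [v], and
   the remainder of [w]. *)
apply: (is_fderiv_quadratic (C := K * (KT' * M + KT * Kv + Kw')) Uo Ul).
  by rewrite mulr_ge0// !addr_ge0// mulr_ge0.
move=> m Um; rewrite -mulrA; move: n.
set h := m - l.
pose rT n := T n m - T n l - om n *: (T' n l h).
pose rw n := w n m - w n l - om n *: (w' n l h).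
apply: (solvable_eq_bound (v := fun n => v n m - v n l - v' l n h)
  (w := fun n => rT n (v n l) + (T n m - T n l) (v n m - v n l) + rw n) (sT l Ul)).
- exists (M + M + K * N * `|h|) => n; apply: ler_normB2.
    by apply: ler_normB2; exact: MP.
  by rewrite (le_trans (bop_le _ _))// ler_wpM2r.
- move=> n; rewrite 2!mulrDl 2!mulrDl; apply: ler_normD2; first apply: ler_normD2.
  + rewrite (le_trans (bop_le _ _))//.
    rewrite [leRHS](_ : _ = (KT' * `|h| ^+ 2 * om n) * M); last by ring.
    apply: ler_pM => //; last exact: MP.
    apply: scaled_norm_le => //; rewrite !scalerBr scalerA mulVf ?gt_eqF// scale1r.
    exact: (taylor1 Uc (fun p Up => TT' n p Up) KT'0 (KT'P n)).
  + rewrite (le_trans (bop_le _ _))//.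
    rewrite [leRHS](_ : _ = (KT * `|h| * om n) * (Kv * `|h|)); last by ring.
    apply: ler_pM => //; last exact: KvP.
    by apply: scaled_norm_le => //; rewrite scalerBr; exact: KTP.
  apply: scaled_norm_le => //; rewrite !scalerBr scalerA mulVf ?gt_eqF// scale1r.
  exact: (taylor1 Uc (fun p Up => ww' n p Up) Kw'0 (Kw'P n)).
- move=> n; rewrite !vE// v'E.
  have -> : (bop_post E (T n l) (v' l n) + om n *: G n l) h =
      T n l (v' l n h) + om n *: (T' n l h (v n l) + w' n l h) by [].
  rewrite /rT /rw !(bopB, bopZ) !bop_subr !scalerDr; zmod.
Qed.

End LinearEquation.

(** * Bounded perturbations of an approximate solution *)

Section Perturbation.
Context {R : realType} {E X : normedModType R}.

Lemma equiC_pair b I (U : set E) k (u : I -> E -> X) : open U ->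
  equiC b U k u -> equiC b U k (fun i l => (l, u i l)).
Proof.
move=> Uo uC.
have H1 : equiC b U k (fun (_ : I) l => @bop_inl R E X l).
  by apply: (equiC_bop _ _ (M := fun=> bop_inl)) => _; exists 1 => // _; exact: bop_inl_norm.
have H2 : equiC b U k (fun i l => @bop_inr R E X (u i l)).
  apply: (equiC_linear (M := fun=> bop_inr)) uC => _.
  by exists 1 => // _; exact: bop_inr_norm.
apply: (equiC_ext Uo _ (equiCD H1 H2)) => i l _.
by apply: injective_projections; rewrite /= ?addr0 ?add0r.
Qed.

Variables (A : int -> bop X X) (om c : int -> R) (K Z0 : R) (U : set E) (k : nat).
Variables (F : int -> E * X -> X) (DF : int -> E * X -> bop (E * X)%type X).
Variables x y : int -> E -> X.
Hypotheses (Uo : open U) (Uc : segment_closed U).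
Hypotheses (c_ge0 : forall n, 0 <= c n) (om0 : forall n, 0 < om n).
Hypothesis c_om : forall n, c n <= om n.
Hypotheses (K0 : 0 <= K) (Z00 : 0 <= Z0).
Hypothesis apriori : forall (v : int -> X) (N : R), 0 <= N ->
  (exists M : R, forall n, `|v n| <= M) ->
  (forall n, `|v (n + 1) - A n (v n)| <= c n * `|v n| + N * om n) ->
  forall n, `|v n| <= K * N.
Hypothesis solvable : forall B : int -> bop X X, (forall n, `|B n| <= c n) ->
  solvable_eq om K (fun n => A n + B n).
Let S := U `*` [set: X].
Hypothesis FDF : forall n p, S p -> is_fderiv (F n) p (DF n p).
Hypothesis Flip : forall n l v v', U l ->
  `|F n (l, v) - F n (l, v')| <= c n * `|v - v'|.
Hypothesis DFC : equiC true S k (fun n p => (om n)^-1 *: DF n p).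
Hypothesis yC : equiC true U k.+1 y.
Let r n l := y (n + 1) l - A n (y n l) - F n (l, y n l).
Hypothesis rC : equiC true U k.+1 (fun n l => (om n)^-1 *: r n l).
Hypothesis xE : forall n l, U l -> x (n + 1) l = A n (x n l) + F n (l, x n l).
Hypothesis xy : forall n l, U l -> `|x n l - y n l| <= Z0.

Let So : open S. Proof. exact: open_strip. Qed.

Let Sc : segment_closed S.
Proof. by move=> p q t [Up _] [Uq _] t01; split=> //; exact: Uc. Qed.

Let SU l v : U l -> S (l, v). Proof. by []. Qed.

(** The Lipschitz constant of [F n] in its second argument bounds the partial derivative, so the
    linearized coefficient is an admissible perturbation in [solvable]. *)
Lemma DF_inr_norm n l v : U l -> `|bop_comp (DF n (l, v)) bop_inr| <= c n.
Proof.
move=> Ul.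
have Fv : is_fderiv (fun v' => F n (l, v')) v (bop_comp (DF n (l, v)) bop_inr).
  exact: is_fderiv_comp (is_fderiv_pairr l v) (FDF n (SU v Ul)).
apply: (is_fderiv_norm_le openT I _ Fv) => [//|v' _].
exact: Flip.
Qed.

Let z n l := x n l - y n l.

Let zE n l : U l ->
  z (n + 1) l = A n (z n l) + (F n (l, x n l) - F n (l, y n l) - r n l).
Proof. by move=> Ul; rewrite /z xE// /r bop_subr; zmod. Qed.

Lemma norm_inr_pair (l l' : E) (v v' : X) : `|(l, v) - (l', v')| <= `|l - l'| + `|v - v'|.
Proof. by rewrite pair_norm /= ge_max lerDl lerDr !normr_ge0. Qed.

(** The difference [z] is bounded although [x] and [y] need not be. In the equation for its
    increment, the part of the increment of [F] caused by [z] has factor [c n] and is absorbed by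
    [apriori]; the rest is [O(om n |m - l|)]. *)
Lemma difference_lip : equi_lip true U z.
Proof.
move=> _; have [Ka Ka0 KaP] := equiC_lip DFC isT.
have [Ly Ly0 LyP] := equiC_lip yC isT; have [Kr Kr0 KrP] := equiC_lip rC isT.
have DFl n p p' : S p -> S p' -> `|DF n p' - DF n p| <= Ka * `|p' - p| * om n.
  by move=> Sp Sp'; apply: scaled_norm_le => //; rewrite scalerBr; exact: KaP.
exists (K * (Ly + Ly + Ka * Z0 + Kr)).
  by rewrite mulr_ge0// !addr_ge0// mulr_ge0.
move=> n l m Ul Um; rewrite -mulrA; move: n.
apply: (apriori (v := fun n => z n m - z n l)).
- by rewrite mulr_ge0// !addr_ge0// mulr_ge0.
- by exists (Z0 + Z0) => n; apply: ler_normB2; exact: xy.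
move=> n.
(* The points of [X] are frozen and only the parameter moves: the derivative in the parameter is a
   difference of [DF] at two points at distance at most [Z0]. *)
have mixed : `|(F n (m, x n l) - F n (m, y n l)) - (F n (l, x n l) - F n (l, y n l))|
    <= Ka * Z0 * om n * `|m - l|.
  apply: (mean_value_ineq (f := fun t => F n (t, x n l) - F n (t, y n l))
    (L := fun t => bop_comp (DF n (t, x n l)) bop_inl -
                   bop_comp (DF n (t, y n l)) bop_inl) Uc _ _ Ul Um).
    move=> t Ut; have D v : is_fderiv (fun t => F n (t, v)) t (bop_comp (DF n (t, v)) bop_inl).
      exact: is_fderiv_comp (is_fderiv_pairl t v) (FDF n (SU v Ut)).
    exact: is_fderivB (D _) (D _).
  move=> t Ut; rewrite (_ : _ - _ = bop_comp (DF n (t, x n l) - DF n (t, y n l)) bop_inl);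
    last exact: bop_ext.
  rewrite (le_trans (bop_comp_norm _ _))// (le_trans (ler_wpM2l _ bop_inl_norm))// mulr1.
  rewrite (le_trans (DFl _ _ _ (SU _ Ut) (SU _ Ut)))// ler_wpM2r ?(ltW (om0 n))//.
  rewrite ler_wpM2l// (le_trans (norm_inr_pair _ _ _ _))// subrr normr0 add0r.
  exact: xy.
have rl : `|r n m - r n l| <= Kr * om n * `|m - l|.
  rewrite mulrAC; apply: scaled_norm_le => //; rewrite scalerBr.
  exact: KrP.
have yl := LyP n l m Ul Um.
have c0 := c_ge0 n.
rewrite !zE// (_ : _ - _ =
  (F n (m, x n m) - F n (m, x n l)) - (F n (m, y n m) - F n (m, y n l)) +
  ((F n (m, x n l) - F n (m, y n l)) - (F n (l, x n l) - F n (l, y n l))) - (r n m - r n l));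
  last by rewrite [A n (z n m - z n l)]bop_subr; zmod.
have xl : `|F n (m, x n m) - F n (m, x n l)| <= c n * `|z n m - z n l| + Ly * om n * `|m - l|.
  rewrite (le_trans (Flip _ _ _ Um))//.
  have xz : `|x n m - x n l| <= `|z n m - z n l| + Ly * `|m - l|.
    have -> : x n m - x n l = (z n m - z n l) + (y n m - y n l) by rewrite /z; zmod.
    exact: ler_normD2.
  rewrite (le_trans (ler_wpM2l c0 xz))// mulrDr lerD2l.
  rewrite [leRHS](_ : _ = om n * (Ly * `|m - l|)); last by ring.
  by rewrite ler_wpM2r// mulr_ge0.
have yl' : `|F n (m, y n m) - F n (m, y n l)| <= Ly * om n * `|m - l|.
  rewrite (le_trans (Flip _ _ _ Um))// (le_trans (ler_pM _ _ (c_om n) yl))//.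
  by rewrite le_eqVlt; apply/orP; left; apply/eqP; ring.
rewrite (le_trans (ler_normB2 (ler_normD2 (ler_normB2 xl yl') mixed) rl))//.
by rewrite le_eqVlt; apply/orP; left; apply/eqP; ring.
Qed.

Lemma xC0 : equiC true U 0 x.
Proof.
have zC : equiC true U 0 z by split=> //; exact: difference_lip.
apply: (equiC_ext Uo _ (equiCD zC (equiC_le (leq0n _) yC))) => n l _.
by rewrite /z subrK.
Qed.

(** Differentiating the equation for [z] gives a linear equation with coefficient [T], which is [A]
    plus the partial derivative of [F] at [x], and forcing [w]. Its bounded solution is the
    derivative of [z], and the derivative [y' + z'] of [x] inherits the smoothness already known for
    [x]. *)
Lemma perturbed_solution_equiC : equiC true U k.+1 x.
Proof.
have /equiCS[yl [y' [yy' y'C]]] := yC; have /equiCS[rl [r' [rr' r'C]]] := rC.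
have y'b := equi_lip_deriv_bdd Uo yl yy'; have r'b := equi_lip_deriv_bdd Uo rl rr'.
pose a n p := (om n)^-1 *: DF n p.
have omK n : (om n)^-1 * om n = 1 by rewrite mulVf// gt_eqF.
have aC j (u : int -> E -> X) : (j <= k)%N -> equiC true U j u ->
    equiC true U j (fun n l => a n (l, u n l)).
  move=> jk uC; apply: (equiC_comp (g := a) (u := fun n l => (l, u n l)) Uo So) => //.
    exact: (equiC_le jk DFC).
  exact: equiC_pair.
pose B n l := bop_comp (DF n (l, x n l)) (@bop_inr R E X).
pose T n l := A n + B n l.
have sT l : U l -> solvable_eq om K (T^~ l).
  by move=> Ul; apply: solvable => n; exact: DF_inr_norm.
have TC j : (j <= k)%N -> equiC true U j x -> equiC true U j (fun n l => (om n)^-1 *: T n l).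
  move=> jk xC; have H := aC j x jk xC.
  have H1 := equiC_linear (b := true) (M := fun _ : int => bop_pre X (@bop_inr R E X)) _ H.
  have H2 := equiCD (equiC_cst true U j (fun n => (om n)^-1 *: A n)) (H1 _).
  apply: (equiC_ext Uo _ (H2 _)) => [n l Ul|_].
    by rewrite /T scalerDr; congr (_ + _); exact: bop_ext.
  exists 1 => // _; apply: bop_norm_le => // g; rewrite (le_trans (bop_comp_norm _ _))//.
  by rewrite mulrC ler_wpM2r// bop_inr_norm.
pose e n l := @bop_inl R E X + bop_comp (@bop_inr R E X) (y' n l).
have eC : equiC true U k e.
  apply: equiCD; first exact: (equiC_cst _ _ _ (fun=> bop_inl)).
  apply: (equiC_linear (M := fun _ : int => bop_post E (@bop_inr R E X))) y'C => _.
  by exists 1 => // _; apply: le_trans bop_inr_norm; exact: bop_post_norm.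
have eb : equi_bdd true U e.
  move=> _; have [M M0 MP] := y'b isT; exists (1 + M); first by rewrite addr_ge0.
  move=> n l Ul; apply: ler_normD2; first exact: bop_inl_norm.
  rewrite (le_trans (bop_comp_norm _ _))// -[leRHS]mul1r ler_pM ?bop_inr_norm//.
  exact: MP.
have [Ka Ka0 KaP] := equiC_lip DFC isT.
(* No bound on [DF / om] itself is available, but its Lipschitz constant and [|x - y| <= Z0] bound
   this difference. *)
pose D n l := a n (l, x n l) - a n (l, y n l).
have Db : equi_bdd true U D.
  move=> _; exists (Ka * Z0) => [|n l Ul]; first by rewrite mulr_ge0.
  rewrite (le_trans (KaP n _ _ (SU _ Ul) (SU _ Ul)))// ler_wpM2l//.
  by rewrite (le_trans (norm_inr_pair _ _ _ _))// subrr normr0 add0r xy.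
pose w n l := om n *: (bop_comp (D n l) (e n l) - r' n l).
have wE n l : (om n)^-1 *: w n l = bop_comp (D n l) (e n l) - r' n l.
  by rewrite /w scalerA omK scale1r.
have wC j : (j <= k)%N -> equiC true U j x -> equiC true U j (fun n l => (om n)^-1 *: w n l).
  move=> jk xC; apply: (@equiC_ext _ true _ _ _ U j
    (fun n l => bop_comp (D n l) (e n l) - r' n l)) => //.
  apply: equiCD; last exact: (equiCN (equiC_le jk r'C)).
  apply: (equiC_bilin Uo (bop_comp_bilinear _ _ _)) => //; last exact: (equiC_le jk eC).
  apply: equiCD; first exact: aC.
  exact: (equiCN (aC j y jk (equiC_le (leqW jk) yC))).
have [N [N0 NP]] : exists N, 0 <= N /\ forall n l, U l -> `|w n l| <= N * om n.
  have [M1 M10 M1P] := Db isT; have [M2 M20 M2P] := eb isT; have [M3 M30 M3P] := r'b isT.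
  exists (M1 * M2 + M3); split=> [|n l Ul]; first by rewrite addr_ge0// mulr_ge0.
  apply: scaled_norm_le => //; rewrite wE; apply: ler_normB2; last exact: M3P.
  by rewrite (le_trans (bop_comp_norm _ _))// ler_pM//; [exact: M1P|exact: M2P].
have z'ex l : exists z' : int -> bop E X, U l -> (forall n, `|z' n| <= K * N) /\
    forall n, z' (n + 1) = bop_post E (T n l) (z' n) + w n l.
  have [Ul|nUl] := pselect (U l); last by exists (fun=> 0).
  have [ex _] := solvable_eq_post E om0 K0 (sT l Ul).
  by have [z' z'P] := ex _ N (fun n => NP n l Ul); exists z'.
have [z' z'P] := choice z'ex.
have z'b : equi_bdd true U (fun n l => z' l n).
  by move=> _; exists (K * N) => [|n l /z'P[]//]; rewrite mulr_ge0.
have xl := equiC_lip xC0.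
have xx' n l : U l -> is_fderiv (x n) l (y' n l + z' l n).
  move=> Ul.
  have [Lx Lx0 LxP] := xl isT; have [Ly Ly0 LyP] := yl isT.
  have [Ly' Ly'0 Ly'P] := equiC_lip y'C isT; have [Kr' Kr'0 Kr'P] := equiC_lip r'C isT.
  suff zz' : is_fderiv (z n) l (z' l n).
    apply: (is_fderiv_ext Uo Ul _ (is_fderivD (yy' n l Ul) zz')) => m _.
    by rewrite /z subrKC.
  have [z'bl z'E] := z'P l Ul.
  (* In turn: the Taylor remainder of [y] seen through the partial derivative at [x] and at [y], the
     Taylor remainders of [F] along [x] and along [y], and that of [r]. *)
  pose C := Ly' + Ly' + Ka * (1 + Lx) ^+ 2 + Ka * (1 + Ly) ^+ 2 + Kr'.
  have C0 : 0 <= C by rewrite !addr_ge0// mulr_ge0// exprn_ge0// addr_ge0.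
  apply: (is_fderiv_quadratic (C := K * C) Uo Ul); first by rewrite mulr_ge0.
  move=> m Um; rewrite -mulrA; move: n.
  set h := m - l.
  pose rho n := y n m - y n l - y' n l h.
  have rhoP n : `|rho n| <= Ly' * `|h| ^+ 2.
    exact: (taylor1 Uc (fun p Up => yy' n p Up) Ly'0 (Ly'P n)).
  pose RF (u : int -> E -> X) n := F n (m, u n m) - F n (l, u n l) -
    DF n (l, u n l) ((m, u n m) - (l, u n l)).
  have RFP u Lu : 0 <= Lu -> (forall n, `|u n m - u n l| <= Lu * `|h|) ->
      forall n, `|RF u n| <= Ka * (1 + Lu) ^+ 2 * `|h| ^+ 2 * om n.
    move=> Lu0 uL n.
    have DFl p q : S p -> S q -> `|DF n q - DF n p| <= (Ka * om n) * `|q - p|.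
      move=> Sp Sq; rewrite mulrAC; apply: scaled_norm_le => //.
      by rewrite scalerBr; exact: KaP.
    have KO : 0 <= Ka * om n by rewrite mulr_ge0// ltW.
    have := taylor1 Sc (fun p Sp => FDF n Sp) KO DFl (SU (u n l) Ul) (SU (u n m) Um).
    move=> /le_trans; apply; rewrite [leRHS](_ : _ = Ka * om n * ((1 + Lu) * `|h|) ^+ 2);
      last by ring.
    rewrite ler_wpM2l// ler_pXn2r// ?nnegrE ?mulr_ge0 ?addr_ge0//.
    rewrite (le_trans (norm_inr_pair _ _ _ _))// mulrDl mul1r lerD2l.
    exact: uL.
  pose rr n := r n m - r n l - om n *: r' n l h.
  have rrP n : `|rr n| <= Kr' * `|h| ^+ 2 * om n.
    apply: scaled_norm_le => //; rewrite scalerBr scalerBr scalerA omK scale1r.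
    exact: (taylor1 Uc (fun p Up => rr' n p Up) Kr'0 (Kr'P n)).
  apply: (solvable_eq_bound (v := fun n => z n m - z n l - z' l n h)
    (w := fun n => B n l (rho n) - bop_comp (DF n (l, y n l)) bop_inr (rho n) +
      RF x n - RF y n - rr n) (sT l Ul)).
  - exists (Z0 + Z0 + K * N * `|h|) => n; apply: ler_normB2.
      by apply: ler_normB2; exact: xy.
    by rewrite (le_trans (bop_le _ _))// ler_wpM2r.
  - move=> n; have Brho v : `|bop_comp (DF n (l, v)) bop_inr (rho n)| <= Ly' * `|h| ^+ 2 * om n.
      rewrite (le_trans (bop_le _ _))// mulrC ler_pM//.
      by rewrite (le_trans (DF_inr_norm _ _ Ul)).
    rewrite {1}/C !mulrDl; apply: ler_normB2 (rrP n); apply: ler_normB2.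
      apply: ler_normD2; first by apply: ler_normB2; exact: Brho.
      by apply: RFP => // i; exact: LxP.
    by apply: RFP => // i; exact: LyP.
  move=> n; rewrite !zE// z'E.
  have -> : (bop_post E (T n l) (z' l n) + w n l) h = A n (z' l n h) + B n l (z' l n h) +
     om n *: (D n l (e n l h) - r' n l h) by [].
  have eh : e n l h = (h, y' n l h).
    by apply: injective_projections; rewrite /= ?addr0 ?add0r.
  have De : om n *: D n l (e n l h) = DF n (l, x n l) (e n l h) - DF n (l, y n l) (e n l h).
    by rewrite /D /a bopB !bopZ -scalerBr scalerA mulrC omK scale1r.
  (* The increment of [x] is written so as to exhibit the error [z n m - z n l - z' l n h], whose
     equation then has coefficient [T]. *)
  have px : (m, x n m) - (l, x n l) =
      e n l h + bop_inr (z n m - z n l - z' l n h + z' l n h + rho n).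
    rewrite eh; apply: injective_projections; rewrite /= ?addr0//.
    by rewrite /rho /z; zmod.
  have py : (m, y n m) - (l, y n l) = e n l h + bop_inr (rho n).
    by rewrite eh; apply: injective_projections; rewrite /= ?addr0// /rho; zmod.
  have Bv v : B n l v = DF n (l, x n l) (bop_inr v) by [].
  rewrite scalerBr De /RF px py /T bopD !Bv /rr.
  rewrite -[bop_comp _ _ (rho n)]/(DF n (l, y n l) (bop_inr (rho n))).
  have -> : A n (z n m - z n l - z' l n h) = A n (z n m) - A n (z n l) - A n (z' l n h).
    by rewrite 2!bop_subr.
  set d := z n m - z n l - z' l n h; move: (rho n) (e n l h) (r' n l h) => v u t.
  move: (om n *: t) => {}t; clearbody d h z.
  rewrite !bop_addr; zmod.
(* Bootstrap: if [x] is of class C^j with [j <= k], so are the rescaled [T] and [w], hence [z'],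
   hence [x] is of class C^(j+1). *)
have main j : (j <= k.+1)%N -> equiC true U j x.
  elim: j => [|j IH] jk; first exact: xC0.
  have xC := IH (ltnW jk).
  apply/equiCS; split=> //; exists (fun n l => y' n l + z' l n); split; first exact: xx'.
  apply: equiCD; first exact: (equiC_le (jk : (j <= k)%N) y'C).
  apply: (solution_equiC Uo Uc om0 K0 (T := fun n l => bop_post E (T n l)) (w := w)) => //.
  - by move=> l Ul; apply: solvable_eq_post => //; exact: sT.
  - exact: (equiC_post Uo (TC j jk xC)).
  - exact: wC.
  - by move=> n l /z'P[].
exact: main.
Qed.

End Perturbation.

(** * The theorem *)

Section Weighted.
Context {R : realType}.
Implicit Types V W : normedModType R.

Lemma smooth_on_sub V W (A B : set V) k (f : V -> W) :
  A `<=` B -> smooth_on B k f -> smooth_on A k f.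
Proof. by move=> AB fB j jk p /AB; exact: fB. Qed.

Lemma fderivn_scale V W (U : set V) k (a : R) (f : V -> W) : open U ->
  smooth_on U k f -> smooth_on U k (fun p => a *: f p) /\
  forall j, (j <= k)%N -> forall p, U p ->
    fderivn j (fun p => a *: f p) p = a *: fderivn j f p.
Proof.
move=> Uo fs.
apply: (fderivn_tower (d := fun j p => a *: fderivn j f p)) => // j jk p Up.
have := is_fderiv_linear (a *: bop_id (mlin V W j)) (fs j jk p Up).
by congr (is_fderiv _ _ _); exact: bop_ext.
Qed.

Lemma equiC_of_weighted_bounds I V W (U : set V) k (u : I -> V -> W)
    (om : I -> R) (K : R) : open U -> segment_closed U -> 0 <= K ->
  (forall i, 0 < om i) -> (forall i, smooth_on U k.+1 (u i)) ->
  (forall i j p, (1 <= j <= k.+1)%N -> U p -> `|fderivn j (u i) p| <= K * om i) ->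
  equiC true U k (fun i p => (om i)^-1 *: u i p).
Proof.
move=> Uo Uc K0 om0 us uK; have H i := fderivn_scale (om i)^-1 Uo (us i).
apply: (equiC_of_bounds Uo Uc K0) => [i|i j p jk Up]; first exact: (H i).1.
rewrite (H i).2//; last by have /andP[] := jk.
by apply: norm_scaled_le => //; exact: uK.
Qed.

(** The factor 2^i comes from splitting each of the [i] directions into its components in [E] and
    [X]. *)
Lemma fderivn_pderivn_bound (E X Y : normedModType R) (S : set E) k (F : E * X -> Y)
    (K : R) i p : open S -> smooth_on (S `*` [set: X]) k F -> 0 <= K ->
  (forall a b l v, (a + b = i)%N -> S l ->
    `|pderivn a b (fun l' v' => F (l', v')) l v| <= K) ->
  (i <= k)%N -> (S `*` [set: X]) p -> `|fderivn i F p| <= 2 ^+ i * K.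
Proof.
move=> So Fs K0 FK ik Sp; apply: mlin_norm_le; first by rewrite mulr_ge0 ?exprn_ge0.
move=> hs hsi; subst i; exact: (dirderiv_bound So Fs K0 FK ik Sp).
Qed.


Lemma residual_smooth (E X : normedModType R) (S : set E) k (A : bop X X)
    (u v g : E -> X) : open S ->
  smooth_on S k u -> smooth_on S k v -> smooth_on S k g ->
  smooth_on S k (fun l => v l - A (u l) - g l) /\
  forall j, (j <= k)%N -> forall l, S l ->
    fderivn j (fun l => v l - A (u l) - g l) l =
    fderivn j v l - mlin_post E A j (fderivn j u l) - fderivn j g l.
Proof.
move=> So us vs gs.
apply: (fderivn_tower (d := fun j l =>
  fderivn j v l - mlin_post E A j (fderivn j u l) - fderivn j g l)) => // j jk l Sl.
apply: is_fderivB (gs j jk l Sl); apply: is_fderivB; first exact: vs.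
exact: is_fderiv_linear (us j jk l Sl).
Qed.

Lemma open_cball V (p : V) (d : R) : open [set q | `|q - p| < d].
Proof.
rewrite openE => q /= qd; change (nbhs q [set q | `|q - p| < d]).
apply/nbhs_normP; exists (d - `|q - p|); first by rewrite /= subr_gt0.
move=> v; rewrite /ball_ /= ltrBrDr => qv.
rewrite (le_lt_trans _ qv)// (_ : v - p = (q - p) - (q - v)); last by zmod.
by rewrite (le_trans (ler_normB _ _))// addrC.
Qed.

Lemma segment_closed_ball V (p : V) (d : R) : segment_closed [set q | `|q - p| < d].
Proof.
move=> u v t /= ud vd t01.
rewrite (le_lt_trans (y := Num.max `|u - p| `|v - p|))//; last by rewrite gt_max ud.
by apply: (@segment_closed_cball R V p) => //=; rewrite le_max lexx ?orbT.
Qed.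

End Weighted.

Theorem theorem4 (R : realType) (X E : completeNormedModType R)
  (Sigma : set E) (Sigma_open : open Sigma)
  (A Ainv : int -> bop X X)
  (AK : forall n, cancel (A n) (Ainv n))
  (AVK : forall n, cancel (Ainv n) (A n))
  (P : int -> bop X X)
  (f : E -> int -> X -> X)
  (f_meas : forall l, Sigma l -> measurable_ZX (f l))
  (c : int -> R) (c_ge0 : forall n, 0 <= c n)
  (f_lip : forall n l x y, Sigma l ->
    `|f l n x - f l n y| <= c n * `|x - y|)
  (no_bounded : forall u : int -> X,
    (forall n, u (n + 1) = A n (u n)) ->
    (exists M : R, forall n, `|u n| <= M) ->
    forall n, u n = 0)
  (q_lt1 : (green_sum A Ainv P c < 1)%E)
  (eps : int -> R) (eps_gt0 : forall n, 0 < eps n)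
  (L_fin : (green_sum A Ainv P eps < +oo)%E)
  (y : E -> int -> X)
  (y_approx : forall l, Sigma l -> forall n,
    `|y l (n + 1) - A n (y l n) - f l n (y l n)| <= eps n)
  (x : E -> int -> X)
  (x_sol : forall l, Sigma l -> forall n,
    x l (n + 1) = A n (x l n) + f l n (x l n))
  (x_close : forall l, Sigma l -> forall n,
    `|x l n - y l n| <=
      fine (green_sum A Ainv P eps) / (1 - fine (green_sum A Ainv P c)))
  (k : nat) (k_gt0 : (0 < k)%N)
  (C : R) (C_gt0 : 0 < C)
  (f_Ck : forall n,
    Ck (Sigma `*` [set: X]) k.+1 (fun p : E * X => f p.1 n p.2))
  (f_bound : forall n i j, (2 <= i <= k.+1)%N -> (j <= i)%N ->
    forall l v, Sigma l ->
    `|pderivn (i - j) j (fun l' v' => f l' n v') l v| <= C * eps n)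
  (y_Ck : forall n, Ck Sigma k.+1 (fun l => y l n))
  (y_deriv : forall i n l, (1 <= i <= k.+1)%N -> Sigma l ->
    `|fderivn i (fun l' => y l' (n + 1)) l
      - mlin_post E (A n) i (fderivn i (fun l' => y l' n) l)
      - fderivn i (fun l' => f l' n (y l' n)) l| <= C * eps n)
  (y_bound : forall l0, Sigma l0 -> exists2 M : R, 1 < M &
    exists Sigma0 : set E, [/\ nbhs l0 Sigma0, Sigma0 `<=` Sigma &
      forall l, Sigma0 l -> forall i n, (1 <= i <= k.+1)%N ->
      `|fderivn i (fun l' => y l' n) l| <= M]) :
  forall n, Ck Sigma k (fun l => x l n).
Proof.
move=> n0.
(* Differentiability and continuity are local, so it suffices to work on a ball around each
   parameter where the derivatives of [y] are bounded. *)
suff local l0 : Sigma l0 -> exists2 U : set E, U l0 & Ck U k (fun l => x l n0).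
  by split=> i ik l0 /local[U Ul0 [UC1 UC2]]; [exact: UC1|exact: UC2].
move=> /y_bound[M M1 [S0 [/nbhs_normP[d d0 dS0] S0Sigma yM]]].
pose U := [set l | `|l - l0| < d].
have US0 l : U l -> S0 l by move=> Ul; apply: dS0; rewrite /ball_ /= distrC.
have USigma l : U l -> Sigma l by move=> /US0/S0Sigma.
exists U; first by rewrite /U /= subrr normr0.
have Uo : open U by exact: open_cball.
have Uc : segment_closed U by exact: segment_closed_ball.
pose F n (p : E * X) := f p.1 n p.2.
have So := open_strip (X := X) Sigma_open.
have Fs n : smooth_on (Sigma `*` [set: X]) k.+1 (F n) by exact/Ck_smooth_on/f_Ck.
(* The weight carries [eps] for the residual and the derivatives of [f] of order at least 2, and [c]
   for its first derivative in [x]. *)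
pose om n := eps n + c n.
have om0 n : 0 < om n by rewrite /om ltr_wpDr.
have eps_om n : eps n <= om n by rewrite /om lerDl.
pose K := 2 ^+ k.+1 * C.
have K0 : 0 <= K by rewrite mulr_ge0 ?exprn_ge0// ltW.
have FK n i p : (2 <= i <= k.+1)%N -> (Sigma `*` [set: X]) p ->
    `|fderivn i (F n) p| <= K * om n.
  move=> /[dup] ik /andP[i2 ik1] Sp.
  have Ce : 0 <= C * eps n by rewrite mulr_ge0// ltW.
  rewrite (le_trans (fderivn_pderivn_bound (K := C * eps n) Sigma_open (Fs n) Ce _ ik1 Sp))//.
    move=> a b l v abi Sl; have bi : (b <= i)%N by rewrite -abi leq_addl.
    have ai : (i - b)%N = a by rewrite -abi addnK.
    by have := f_bound n i b ik bi l v Sl; rewrite ai.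
  rewrite /K -mulrA ler_pM ?exprn_ge0// ?ler_weXn2l ?ler1n//.
  by rewrite ler_pM2l.
(* With [k = k'.+1] the map [F n] is of class C^(k'+2); its derivative is uniformly of class C^k'
   relative to the weight, and [x] gains one order over that. *)
case: k k_gt0 => [//|k'] _ in f_Ck f_bound y_Ck y_deriv y_bound yM Fs K K0 FK *.
have yS n : smooth_on Sigma k'.+2 (fun l => y l n) by exact: Ck_smooth_on.
(* Differentiability of the composite lets [y_deriv] be read as a bound on the derivatives of the
   residual. *)
have gS n : smooth_on Sigma k'.+2 (fun l => F n (l, y l n)).
  have H : equiC false Sigma k'.+2 (fun (_ : unit) l => F n (l, y l n)).
    apply: (equiC_comp (g := fun _ : unit => F n) (u := fun _ l => (l, y l n))
      Sigma_open So) => //.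
      by apply/equiC_smooth.
    by apply: equiC_pair => //; apply/equiC_smooth.
  by have [/(_ tt)] := (equiC_smooth _ _ _ Sigma_open).1 H.
pose q := fine (green_sum A Ainv P c); pose L := fine (green_sum A Ainv P eps).
have q0 : 0 <= q by exact: fine_green_sum_ge0.
have L0 : 0 <= L by exact: fine_green_sum_ge0.
have q1 : 0 < 1 - q by rewrite subr_gt0; exact: (green_q_lt1 q_lt1).
have UXS : U `*` [set: X] `<=` Sigma `*` [set: X] by move=> p [/USigma].
apply: (@equiC_Ck _ _ _ _ _ _ (fun n l => x l n)) => //.
apply: (@perturbed_solution_equiC R E X A om c ((q + L) / (1 - q)) (L / (1 - q)) U k' F
  (fun n => fderiv (F n)) (fun n l => x l n) (fun n l => y l n)) => //.
- by move=> n; rewrite /om lerDr ltW.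
- by rewrite divr_ge0 ?(ltW q1)// addr_ge0.
- by rewrite divr_ge0 ?(ltW q1).
- move=> v N N0 vb vN; exact: (apriori_bound AVK c_ge0 no_bounded q_lt1 L_fin N0 vb vN).
- move=> B Bc; exact: (solvable_eq_perturbed AVK c_ge0 eps_gt0 no_bounded q_lt1 L_fin Bc).
- by move=> n p /UXS Sp; exact: (Fs n 0%N).
- by move=> n l v v' /USigma Sl; exact: f_lip.
(* Orders 1 to k'+1 of [fderiv (F n)] are orders 2 to k'+2 of [F n], exactly the range of [FK]. *)
- apply: (equiC_of_weighted_bounds (open_strip Uo) _ K0) => //.
  + by move=> p p' t [Up _] [Up' _] t01; split=> //; exact: Uc.
  + move=> n; apply: (smooth_on_sub UXS).
    exact: (smooth_on_fderiv So (Fs n)).1.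
  + move=> n j p /andP[j1 jk] /UXS Sp.
    rewrite (smooth_on_fderiv So (Fs n)).2// (le_trans (bop_le _ _))//.
    rewrite (le_trans (ler_wpM2r _ (mlin_out_norm _ _ _)))// mul1r.
    by apply: FK => //; rewrite !ltnS j1.
- apply: (equiC_of_bounds (K := M)) => //.
  + by rewrite (le_trans ler01)// ltW.
  + by move=> n; apply: (smooth_on_sub USigma).
  + by move=> n j l jk /US0 Sl; exact: yM.
- have H n := residual_smooth (A n) Sigma_open (yS n) (yS (n + 1)) (gS n).
  apply: (equiC_of_weighted_bounds (K := C)) => //; first exact: ltW.
  + by move=> n; apply: (smooth_on_sub USigma); exact: (H n).1.
  + move=> n j l jk /USigma Sl; rewrite (H n).2//; last by have /andP[] := jk.
    by rewrite (le_trans (y_deriv j n l jk Sl))// ler_pM2l.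
- by move=> n l /USigma Sl; exact: x_sol.
- by move=> n l /USigma Sl; exact: x_close.
Qed.
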